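(* Let $x\in(0,1)$ and let $f(z)=\sum_{m=0}^\infty f_m z^m$ with $|f_m|\le1$ for all $m\ge0$. If $n$ is an integer with $n\ge n_0(x)$, then \[ |r_n(f;z)|\le \frac{|z|^{2n+1}}{x-|z|}\cdot\frac{2x}{(1-x)^{2n+2}}\cdot\frac{(n!)^2}{((2n)!)^2}\qquad\text{for all } |z|<x. \] Moreover this is sharp in order in $n$: for $g(z)=z/(1-z)=\sum_{m\ge1}z^m$ (which satisfies the hypothesis) and every $n\ge n_0(x)$, \[ \max_{|z|=x}|r_n(g;z)|\ge \frac{x^{2n+1}}{(1-x)^{2n+2}}\cdot\frac{(n!)^2}{((2n)!)^2}. \] In particular, if $n\ge13$ and $x_n=\sqrt n/(1+\sqrt n)$, then \[ |r_n(f;z)|\le \frac{|z|^{2n+1}}{x_n-|z|}\cdot\frac{0.92^{2n}}{n^{\,n-1}}\qquad\text{for all } |z|<x_n. \]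
   Context: For $n\ge1$ let $y_n(z)=\sum_{k=0}^{n}\frac{(n+k)!}{(n-k)!\,k!}\left(\frac{z}{2}\right)^k$ be the $n$-th Bessel polynomial and let $\alpha_{n1},\dots,\alpha_{nn}$ be its zeros (they are simple). Put $a_{nk}=1-\alpha_{nk}/2$ and $b_{nk}=1+\alpha_{nk}/2$ for $k=1,\dots,n$. For $f$ analytic where needed define $r_n(f;z)=zf'(z)-\sum_{k=1}^n\big(f(a_{nk}z)-f(b_{nk}z)\big)$. For $x\in(0,1)$ put $n_0(x)=\max\{14,\;x^2(1-x)^{-2}\}-1$. *)

(* Defs.v *)
From Stdlib Require Import Reals Lra Lia Arith Factorial.
Open Scope R_scope.

Definition Cplx : Type := (R * R)%type.
Definition RtoC (r : R) : Cplx := (r, 0).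
Definition Cadd (u v : Cplx) : Cplx := (fst u + fst v, snd u + snd v).
Definition Copp (u : Cplx) : Cplx := (- fst u, - snd u).
Definition Csub (u v : Cplx) : Cplx := Cadd u (Copp v).
Definition Cmul (u v : Cplx) : Cplx :=
  (fst u * fst v - snd u * snd v, fst u * snd v + snd u * fst v).
Definition Cinv (u : Cplx) : Cplx :=
  (fst u / (fst u ^ 2 + snd u ^ 2), - snd u / (fst u ^ 2 + snd u ^ 2)).
Definition Cdiv (u v : Cplx) : Cplx := Cmul u (Cinv v).
Definition Cnorm (u : Cplx) : R := sqrt (fst u ^ 2 + snd u ^ 2).
Fixpoint Cpow (u : Cplx) (k : nat) : Cplx :=
  match k with O => RtoC 1 | S k' => Cmul u (Cpow u k') end.

Fixpoint Csum (N : nat) (u : nat -> Cplx) : Cplx :=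
  match N with O => RtoC 0 | S N' => Cadd (Csum N' u) (u N') end.

Definition Cseries_cv (u : nat -> Cplx) (l : Cplx) : Prop :=
  Un_cv (fun N => Cnorm (Csub (Csum (S N) u) l)) 0.

Definition has_cderiv (f : Cplx -> Cplx) (z l : Cplx) : Prop :=
  forall eps, eps > 0 -> exists delta, delta > 0 /\
    forall h : Cplx, 0 < Cnorm h < delta ->
      Cnorm (Csub (Cdiv (Csub (f (Cadd z h)) (f z)) h) l) < eps.

Definition bessel_coef (n k : nat) : R :=
  INR (fact (n + k)) / (INR (fact (n - k)) * INR (fact k)).
Definition bessel_y (n : nat) (z : Cplx) : Cplx :=
  Csum (S n) (fun k => Cmul (RtoC (bessel_coef n k)) (Cpow (Cmul z (RtoC (/ 2))) k)).

Definition bessel_zeros (n : nat) (alpha : nat -> Cplx) : Prop :=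
  (forall i, (i < n)%nat -> bessel_y n (alpha i) = RtoC 0) /\
  (forall i j, (i < n)%nat -> (j < n)%nat -> i <> j -> alpha i <> alpha j).

Definition a_nk (alpha : nat -> Cplx) (k : nat) : Cplx := Csub (RtoC 1) (Cmul (alpha k) (RtoC (/ 2))).
Definition b_nk (alpha : nat -> Cplx) (k : nat) : Cplx := Cadd (RtoC 1) (Cmul (alpha k) (RtoC (/ 2))).

(** r_n(f; z) = z f'(z) - sum_k (f(a_k z) - f(b_k z)), with fz' standing for f'(z). *)
Definition r_n (n : nat) (alpha : nat -> Cplx) (f : Cplx -> Cplx) (z fz' : Cplx) : Cplx :=
  Csub (Cmul z fz')
       (Csum n (fun k => Csub (f (Cmul (a_nk alpha k) z)) (f (Cmul (b_nk alpha k) z)))).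

Definition n0 (x : R) : R := Rmax 14 (x ^ 2 / (1 - x) ^ 2) - 1.

Definition is_power_series (fc : nat -> Cplx) (f : Cplx -> Cplx) : Prop :=
  forall w, Cnorm w < 1 -> Cseries_cv (fun m => Cmul (fc m) (Cpow w m)) (f w).

Definition g_fun (z : Cplx) : Cplx := Cdiv z (Csub (RtoC 1) z).

Definition factor_n (n : nat) : R := (INR (fact n)) ^ 2 / (INR (fact (2 * n))) ^ 2.

(* Main.v *)
From Coquelicot Require Import Coquelicot.
Require Import Defs.
From Stdlib Require Import Reals Lra Lia Psatz List Arith Factorial.
Open Scope R_scope.

(** Write [S_p] for the sum of the [p]-th powers of the zeros [alpha_k] of [y_n].  The
    differential equation [z^2 y'' + (2z+2) y' = n(n+1) y] gives
    [alpha_k^2 sum_(j<>k) 1/(alpha_k - alpha_j) = -(alpha_k + 1)], from which follow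
    the bound [|alpha_k| <= 2/(n+1)] and a quadratic recurrence for the [S_p], whose
    solution has [S_1 = -1], [S_3 = ... = S_(2n-1) = 0].  Comparing with the polynomial
    whose roots are the [alpha_k^2], [|S_(2n+1)| = (prod |alpha_k|)^2 = 4^n (n!/(2n)!)^2],
    and the later odd power sums decay geometrically.  Expanding [(1 -/+ alpha_k/2)^m]
    by the binomial formula, the [m]-th Taylor coefficient of [r_n(f; z)] is
    [f_m sum_(M>=n) C(m, 2M+1) 4^-M S_(2M+1)], which is estimated termwise.  For
    [f = g] the odd power sums can be summed in closed form:
    [r_n(g; z) = z/(1-z)^2 S_(2n+1) / prod_k (X - alpha_k^2)], [X = 4 (1-z)^2/z^2], and
    at [z = x] the product is at most [X^n]. *)

(** * Complex arithmetic and finite sums *)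

(* In the recurrence the coefficient of [S_(2M+1)] is [M - n]. This forces the earlier odd sums to
   vanish but gives nothing at [M = n], so the size of [S_(2n+1)] has to come from elsewhere, namely
   from the product of the zeros, known because [y_n(0) = 1]. Beyond that index the recurrence is
   linear in the odd sums with the even sums as weights. Decay at rate [r = 2/(n+1)] follows once
   these weights, measured in powers of [r], add up to at most 1; the 14 in [n0] supplies the
   [n >= 13] under which this is checked. The other half of [n0], [(x/(1-x))^2 <= n+1], makes the
   successive bounds in a Taylor coefficient shrink at least by half, whence the factor 2 of the
   main bound; for [g] it gives [X >= 4/(n+1)] at [z = x]. The coefficients are bounded after
   multiplication by [x^m], uniformly in [m], so the sum over [m > 2n] is geometric with ratio
   [|z|/x], which produces the denominator [x - |z|]. *)
Declare Scope cplx_scope.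
Delimit Scope cplx_scope with X.
Bind Scope cplx_scope with Cplx.
Notation "0" := (RtoC 0) : cplx_scope.
Notation "1" := (RtoC 1) : cplx_scope.
Notation "2" := (RtoC 2) : cplx_scope.
Infix "+" := Cadd : cplx_scope.
Infix "-" := Csub : cplx_scope.
Infix "*" := Cmul : cplx_scope.
Infix "/" := Cdiv : cplx_scope.
Infix "^" := Cpow : cplx_scope.
Notation "- x" := (Copp x) : cplx_scope.
Arguments RtoC r%_R.
Arguments Cadd (u v)%_X. Arguments Csub (u v)%_X. Arguments Cmul (u v)%_X.
Arguments Cdiv (u v)%_X. Arguments Copp u%_X. Arguments Cinv u%_X. Arguments Cnorm u%_X.
Arguments Cpow u%_X k%_nat.

Lemma Cplx_eta (u v : Cplx) : fst u = fst v -> snd u = snd v -> u = v.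
Proof. destruct u, v; cbn; intros; congruence. Qed.

(** The operations of [Cplx] are convertible with those of Coquelicot's [C], so the field structure,
    and below the facts about the modulus, carry over by [exact]. *)
Lemma Cplx_field_theory :
  field_theory (RtoC 0) (RtoC 1) Cadd Cmul Csub Copp Cdiv Cinv (@eq Cplx).
Proof. exact C_field_theory. Qed.

Add Field Cplx_field : Cplx_field_theory.

(* [field] unfolds the unit in its side conditions. *)
Ltac cfield := field; try change (R1, R0) with (RtoC 1); auto 6.

Lemma RtoC_add (a b : R) : RtoC (a + b) = (RtoC a + RtoC b)%X.
Proof. apply Cplx_eta; cbn; ring. Qed.
Lemma RtoC_sub (a b : R) : RtoC (a - b) = (RtoC a - RtoC b)%X.
Proof. apply Cplx_eta; cbn; ring. Qed.
Lemma RtoC_mul (a b : R) : RtoC (a * b) = (RtoC a * RtoC b)%X.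
Proof. apply Cplx_eta; cbn; ring. Qed.
Lemma RtoC_inj (a b : R) : RtoC a = RtoC b -> a = b.
Proof. intros H; now injection H. Qed.
Lemma RtoC_neq0 (a : R) : a <> 0 -> RtoC a <> RtoC 0.
Proof. intros H E; now apply H, RtoC_inj. Qed.
Lemma RtoC_2 : RtoC 2 = (1 + 1)%X.
Proof. apply Cplx_eta; cbn; ring. Qed.
Lemma RtoC_inv (a : R) : a <> 0 -> RtoC (/ a) = Cinv (RtoC a).
Proof. intros Ha; apply Cplx_eta; cbn; field; trivial. Qed.
Lemma RtoC_pow (a : R) (k : nat) : RtoC (a ^ k) = (RtoC a ^ k)%X.
Proof. induction k; cbn; [easy|]. now rewrite <- IHk, RtoC_mul. Qed.
Lemma RtoC_INR_S (n : nat) : RtoC (INR (S n)) = (RtoC (INR n) + 1)%X.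
Proof. now rewrite S_INR, RtoC_add. Qed.
Lemma Cplx_two_neq0 : (1 + 1)%X <> 0%X.
Proof. rewrite <- RtoC_2; apply RtoC_neq0; lra. Qed.

Lemma Cmul_comm (u v : Cplx) : (u * v = v * u)%X.
Proof. ring. Qed.
Lemma Cmul_eq0 (u v : Cplx) : (u * v = 0)%X -> u = 0%X \/ v = 0%X.
Proof.
intros H; destruct (Ceq_dec u 0%X) as [E|E]; [now left|right].
replace v with (Cinv u * (u * v))%X by (field; exact E). rewrite H; ring.
Qed.
Lemma Cmul_cancel_l (u v w : Cplx) : u <> 0%X -> (u * v = u * w)%X -> v = w.
Proof.
intros Hu H. replace v with (Cinv u * (u * v))%X by (field; exact Hu).
rewrite H; field; exact Hu.
Qed.
Lemma Csub_eq0 (u v : Cplx) : (u - v = 0)%X -> u = v.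
Proof. intros H. replace u with (u - v + v)%X by ring. rewrite H; ring. Qed.

Lemma Cnorm_0 : Cnorm 0 = 0.
Proof. exact Cmod_0. Qed.
Lemma Cnorm_ge0 (u : Cplx) : 0 <= Cnorm u.
Proof. exact (Cmod_ge_0 u). Qed.
Lemma Cnorm_mul (u v : Cplx) : Cnorm (u * v) = Cnorm u * Cnorm v.
Proof. exact (Cmod_mult u v). Qed.
Lemma Cnorm_triangle (u v : Cplx) : Cnorm (u + v) <= Cnorm u + Cnorm v.
Proof. exact (Cmod_triangle u v). Qed.
Lemma Cnorm_opp (u : Cplx) : Cnorm (- u) = Cnorm u.
Proof. exact (Cmod_opp u). Qed.
Lemma Cnorm_sub_le (u v : Cplx) : Cnorm (u - v) <= Cnorm u + Cnorm v.
Proof. rewrite <- (Cnorm_opp v). apply Cnorm_triangle. Qed.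
Lemma Cnorm_sub_ge (u v : Cplx) : Cnorm u - Cnorm v <= Cnorm (u - v).
Proof.
pose proof (Cnorm_triangle (u - v) v) as H.
replace (u - v + v)%X with u in H by ring. lra.
Qed.
Lemma Cnorm_gt0 (u : Cplx) : u <> 0%X -> 0 < Cnorm u.
Proof. exact (proj1 (Cmod_gt_0 u)). Qed.
Lemma Cnorm_neq0 (u : Cplx) : 0 < Cnorm u -> u <> 0%X.
Proof. intros H E; rewrite E, Cnorm_0 in H; lra. Qed.
Lemma Cnorm_RtoC (a : R) : Cnorm (RtoC a) = Rabs a.
Proof. exact (Cmod_R a). Qed.
Lemma Cnorm_RtoC_pos (a : R) : 0 <= a -> Cnorm (RtoC a) = a.
Proof. intros; rewrite Cnorm_RtoC; now apply Rabs_pos_eq. Qed.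
Lemma Cnorm_inv (u : Cplx) : u <> 0%X -> Cnorm (Cinv u) = / Cnorm u.
Proof. exact (Cmod_inv u). Qed.
Lemma Cnorm_div (u v : Cplx) : v <> 0%X -> Cnorm (u / v) = Cnorm u / Cnorm v.
Proof. intros; unfold Cdiv; now rewrite Cnorm_mul, Cnorm_inv. Qed.
Lemma Cnorm_pow (u : Cplx) (k : nat) : Cnorm (u ^ k) = Cnorm u ^ k.
Proof.
induction k; cbn [Cpow pow]; [apply Cnorm_RtoC_pos; lra|].
now rewrite Cnorm_mul, IHk.
Qed.
Lemma Cnorm_sq (u : Cplx) : Cnorm u ^ 2 = fst u ^ 2 + snd u ^ 2.
Proof. unfold Cnorm; apply pow2_sqrt; nra. Qed.
Lemma fst_le_Cnorm (u : Cplx) : Rabs (fst u) <= Cnorm u.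
Proof. eapply Rle_trans; [apply Rmax_l|exact (Rmax_Cmod u)]. Qed.
Lemma snd_le_Cnorm (u : Cplx) : Rabs (snd u) <= Cnorm u.
Proof. eapply Rle_trans; [apply Rmax_r|exact (Rmax_Cmod u)]. Qed.
Lemma Cnorm_le_components (u : Cplx) : Cnorm u <= Rabs (fst u) + Rabs (snd u).
Proof.
replace u with (Cadd (fst u, 0%R) (0%R, snd u)) by (apply Cplx_eta; cbn; ring).
eapply Rle_trans; [apply Cnorm_triangle|]. cbn [Cadd fst snd].
rewrite Rplus_0_r, Rplus_0_l. unfold Cnorm; cbn [fst snd].
rewrite <- !sqrt_Rsqr_abs; unfold Rsqr.
right; f_equal; f_equal; ring.
Qed.

Lemma Cpow_add (u : Cplx) (i j : nat) : (u ^ (i + j) = u ^ i * u ^ j)%X.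
Proof. induction i; cbn; [ring|rewrite IHi; ring]. Qed.
Lemma Cpow_mul (u v : Cplx) (k : nat) : ((u * v) ^ k = u ^ k * v ^ k)%X.
Proof. induction k; cbn; [ring|rewrite IHk; ring]. Qed.
Lemma Cpow_sq (u : Cplx) (k : nat) : ((u * u) ^ k = u ^ (2 * k))%X.
Proof. rewrite Cpow_mul, <- Cpow_add; f_equal; lia. Qed.

Lemma Csum_ext (N : nat) (u v : nat -> Cplx) :
  (forall i, (i < N)%nat -> u i = v i) -> Csum N u = Csum N v.
Proof.
induction N; cbn; [easy|]; intros H.
rewrite IHN, H; auto with arith.
Qed.
Lemma Csum_0 (N : nat) (u : nat -> Cplx) :
  (forall i, (i < N)%nat -> u i = 0%X) -> Csum N u = 0%X.
Proof. induction N; cbn; [easy|]; intros H. rewrite IHN, H; auto with arith; ring. Qed.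
Lemma Csum_add (N : nat) (u v : nat -> Cplx) :
  Csum N (fun i => u i + v i)%X = (Csum N u + Csum N v)%X.
Proof. induction N; cbn; [|rewrite IHN]; ring. Qed.
Lemma Csum_sub (N : nat) (u v : nat -> Cplx) :
  Csum N (fun i => u i - v i)%X = (Csum N u - Csum N v)%X.
Proof. induction N; cbn; [|rewrite IHN]; ring. Qed.
Lemma Csum_scal (N : nat) (c : Cplx) (u : nat -> Cplx) :
  Csum N (fun i => c * u i)%X = (c * Csum N u)%X.
Proof. induction N; cbn; [|rewrite IHN]; ring. Qed.
Lemma Csum_const (N : nat) (c : Cplx) : Csum N (fun _ => c) = (RtoC (INR N) * c)%X.
Proof. induction N; [cbn; ring|]. cbn [Csum]. rewrite IHN, RtoC_INR_S; ring. Qed.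
Lemma Csum_exchange (N M : nat) (u : nat -> nat -> Cplx) :
  Csum N (fun i => Csum M (u i)) = Csum M (fun j => Csum N (fun i => u i j)).
Proof.
induction N; cbn; [symmetry; now apply Csum_0|]. now rewrite IHN, Csum_add.
Qed.
Lemma Csum_first (N : nat) (u : nat -> Cplx) :
  Csum (S N) u = (u O + Csum N (fun i => u (S i)))%X.
Proof.
induction N; [cbn; ring|].
change (Csum (S (S N)) u) with (Csum (S N) u + u (S N))%X. rewrite IHN; cbn; ring.
Qed.
Lemma Csum_split (N M : nat) (u : nat -> Cplx) :
  Csum (N + M) u = (Csum N u + Csum M (fun i => u (N + i)%nat))%X.
Proof.
induction M; [rewrite Nat.add_0_r; cbn; ring|].
rewrite Nat.add_succ_r; cbn; rewrite IHM; ring.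
Qed.
Lemma Csum_rev (N : nat) (u : nat -> Cplx) :
  Csum N (fun i => u (N - 1 - i)%nat) = Csum N u.
Proof.
induction N; [easy|]. rewrite Csum_first. cbn [Csum].
rewrite <- IHN. replace (S N - 1 - 0)%nat with N by lia.
rewrite (Csum_ext N _ (fun i => u (N - 1 - i)%nat)); [ring|].
intros i Hi; f_equal; lia.
Qed.
Lemma Csum_even_odd (N : nat) (u : nat -> Cplx) :
  Csum (2 * N) u =
  (Csum N (fun i => u (2 * i)%nat) + Csum N (fun i => u (2 * i + 1)%nat))%X.
Proof.
induction N; [cbn; ring|].
replace (2 * S N)%nat with (S (S (2 * N))) by lia. cbn [Csum]. rewrite IHN.
replace (S (2 * N)) with (2 * N + 1)%nat by lia. ring.
Qed.
Lemma Csum_delta (N k : nat) (c : Cplx) : (k < N)%nat ->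
  Csum N (fun j => if Nat.eqb k j then c else 0%X) = c.
Proof.
induction N; [lia|]; intros H; cbn [Csum].
destruct (Nat.eqb_spec k N) as [->|Hk].
- rewrite Csum_0; [ring|]. intros i Hi. destruct (Nat.eqb_spec N i); [lia|easy].
- rewrite IHN by lia; ring.
Qed.

Fixpoint Rsum (N : nat) (u : nat -> R) : R :=
  match N with O => 0 | S N' => Rsum N' u + u N' end.

Lemma fst_Csum (N : nat) (u : nat -> Cplx) : fst (Csum N u) = Rsum N (fun i => fst (u i)).
Proof. induction N; cbn; [easy|now rewrite IHN]. Qed.
Lemma snd_Csum (N : nat) (u : nat -> Cplx) : snd (Csum N u) = Rsum N (fun i => snd (u i)).
Proof. induction N; cbn; [easy|now rewrite IHN]. Qed.
Lemma Rsum_le (N : nat) (u v : nat -> R) :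
  (forall i, (i < N)%nat -> u i <= v i) -> Rsum N u <= Rsum N v.
Proof. induction N; cbn; [lra|]; intros H. apply Rplus_le_compat; auto with arith. Qed.
Lemma Rsum_const (N : nat) (c : R) : Rsum N (fun _ => c) = INR N * c.
Proof. induction N; [cbn; ring|]. cbn [Rsum]. rewrite IHN, S_INR; ring. Qed.
Lemma Rsum_scal (N : nat) (c : R) (u : nat -> R) :
  Rsum N (fun i => c * u i) = c * Rsum N u.
Proof. induction N; cbn; [|rewrite IHN]; ring. Qed.
Lemma Rsum_add (N : nat) (u v : nat -> R) :
  Rsum N (fun i => u i + v i) = Rsum N u + Rsum N v.
Proof. induction N; cbn; [|rewrite IHN]; ring. Qed.
Lemma Rsum_geom (N : nat) (q : R) : Rsum N (fun i => q ^ i) * (1 - q) = 1 - q ^ N.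
Proof. induction N; cbn; [ring|]. rewrite Rmult_plus_distr_r, IHN; ring. Qed.
Lemma Rsum_geom_le (N : nat) (q : R) : 0 <= q < 1 -> Rsum N (fun i => q ^ i) <= / (1 - q).
Proof.
intros Hq. apply Rmult_le_reg_r with (1 - q); [lra|].
rewrite Rsum_geom, Rinv_l by lra. pose proof (pow_le q N); lra.
Qed.
Lemma Cnorm_Csum_le (N : nat) (u : nat -> Cplx) :
  Cnorm (Csum N u) <= Rsum N (fun i => Cnorm (u i)).
Proof.
induction N; cbn [Csum Rsum]; [rewrite Cnorm_0; lra|].
eapply Rle_trans; [apply Cnorm_triangle|lra].
Qed.

(** * Polynomials and the differential equation *)

(* Horner evaluation of the polynomial with coefficient list [p], lowest degree
   first, and of its first two derivatives. *)
Fixpoint ev0 (p : list Cplx) (z : Cplx) : Cplx :=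
  match p with nil => RtoC 0 | cons a p' => Cadd a (Cmul z (ev0 p' z)) end.
Fixpoint ev1 (p : list Cplx) (z : Cplx) : Cplx :=
  match p with nil => RtoC 0 | cons a p' => Cadd (ev0 p' z) (Cmul z (ev1 p' z)) end.
Fixpoint ev2 (p : list Cplx) (z : Cplx) : Cplx :=
  match p with
  | nil => RtoC 0
  | cons a p' => Cadd (Cmul (RtoC 2) (ev1 p' z)) (Cmul z (ev2 p' z))
  end.

(** Horner's scheme: the quotient by [z - a] lists the values at [a] of the successive tails, so it
    keeps the leading coefficient. The product rule is stated as a polynomial identity, which keeps
    the use of the differential equation algebraic. *)
Lemma synthetic_division (p : list Cplx) (b a : Cplx) : exists q : list Cplx,
  length q = length p /\ (p <> nil -> last q 0%X = last p 0%X) /\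
  forall z, ev0 (b :: p) z = (ev0 (b :: p) a + (z - a) * ev0 q z)%X /\
            ev1 (b :: p) z = (ev0 q z + (z - a) * ev1 q z)%X /\
            ev2 (b :: p) z = (2 * ev1 q z + (z - a) * ev2 q z)%X.
Proof.
revert b; induction p as [|c p IH]; intros b.
- exists nil; cbn; repeat split; try easy; rewrite ?RtoC_2; ring.
- destruct (IH c) as (q & Hl & Hlast & Hq).
  exists (ev0 (c :: p) a :: q)%list. split; [cbn; now rewrite Hl|split].
  + intros _. destruct p as [|d p].
    * destruct q; [|easy]. cbn; ring.
    * change (last (c :: d :: p) 0%X) with (last (d :: p) 0%X).
      rewrite <- Hlast by easy. now destruct q.
  + intros z. destruct (Hq z) as (E0 & E1 & E2).
    remember (c :: p)%list as cp. cbn [ev0 ev1 ev2].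
    rewrite E0, E1, E2. rewrite RtoC_2. repeat split; ring.
Qed.

Fixpoint lprod (l : list Cplx) : Cplx :=
  match l with nil => RtoC 1 | cons u l' => Cmul u (lprod l') end.
Fixpoint lsum (l : list Cplx) : Cplx :=
  match l with nil => RtoC 0 | cons u l' => Cadd u (lsum l') end.

(** One root is divided out at a time; the others remain roots of the quotient because they differ
    from it. The second part is the logarithmic derivative, multiplied through by the value of
    [q]. *)
Lemma factor_roots (l : list Cplx) : forall q : list Cplx,
  NoDup l -> length q = S (length l) -> (forall b, In b l -> ev0 q b = 0%X) ->
  forall z, ev0 q z = (last q 0 * lprod (map (fun b => z - b) l))%X /\
    ((forall b, In b l -> z <> b) ->
     ev1 q z = (ev0 q z * lsum (map (fun b => 1 / (z - b)) l))%X).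
Proof.
induction l as [|a l IH]; intros q Hnd Hlen Hroots z.
- destruct q as [|c [|? ?]]; try easy. cbn. split; intros; ring.
- destruct q as [|b q]; [easy|]. cbn in Hlen.
  destruct (synthetic_division q b a) as (q' & Hl & Hlast & Hq).
  assert (Ha : ev0 (b :: q) a = 0%X) by (apply Hroots; now left).
  inversion Hnd as [|? ? Hnin Hnd']; subst.
  assert (Hne : q <> nil) by (destruct q; easy).
  destruct (IH q' Hnd' ltac:(lia)) with (z := z) as (P0 & P1).
  { intros c Hc.
    pose proof (Hroots c (or_intror Hc)) as H.
    rewrite (proj1 (Hq c)), Ha in H.
    destruct (Cmul_eq0 (c - a) (ev0 q' c)) as [E|E]; [rewrite <- H; ring| |easy].
    apply Csub_eq0 in E; subst c; easy. }
  destruct (Hq z) as (E0 & E1 & _). rewrite Ha in E0.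
  split.
  + rewrite E0, P0, (Hlast Hne).
    replace (last (b :: q) 0%X) with (last q 0%X) by now destruct q.
    cbn; ring.
  + intros Hz. rewrite E1, P1, E0 by (intros; apply Hz; now right).
    cbn [map lsum]. field.
    intros E; apply (Hz a (or_introl eq_refl)). now apply Csub_eq0.
Qed.

Lemma lprod_neq0 (l : list Cplx) (f : Cplx -> Cplx) :
  (forall b, In b l -> f b <> 0%X) -> lprod (map f l) <> 0%X.
Proof.
induction l as [|a l IH]; cbn; intros H.
- apply RtoC_neq0; lra.
- intros E; apply Cmul_eq0 in E as [E|E].
  + now apply (H a); [left|].
  + apply IH; auto.
Qed.

(** A segment of the coefficients, from degree [i] on, rather than the whole list, so that an
    induction can remove the lowest term. *)
Definition bessel_list (n : nat) (i m : nat) : list Cplx :=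
  map (fun k => Cmul (RtoC (bessel_coef n k)) (Cpow (RtoC (/ 2)) k)) (seq i m).

Lemma ev0_map_seq (d : nat -> Cplx) (z : Cplx) (m i : nat) :
  ev0 (map d (seq i m)) z = Csum m (fun j => d (i + j)%nat * z ^ j)%X.
Proof.
revert i; induction m; intros i; [easy|].
rewrite Csum_first. cbn [seq map ev0]. rewrite IHm, <- Csum_scal, Nat.add_0_r.
f_equal; [cbn; ring|]. apply Csum_ext; intros j _.
replace (S i + j)%nat with (i + S j)%nat by lia. cbn; ring.
Qed.

Lemma bessel_y_ev0 (n : nat) (z : Cplx) : bessel_y n z = ev0 (bessel_list n 0 (S n)) z.
Proof.
unfold bessel_y, bessel_list. rewrite ev0_map_seq. apply Csum_ext; intros j _.
cbn [Nat.add]. rewrite Cpow_mul; ring.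
Qed.

Lemma bessel_coef_rec (n i : nat) : (i < n)%nat ->
  INR (S i) * bessel_coef n (S i) = (INR n * (INR n + 1) - INR i * (INR i + 1)) * bessel_coef n i.
Proof.
intros Hi. unfold bessel_coef.
replace (n + S i)%nat with (S (n + i)) by lia.
replace (n - i)%nat with (S (n - S i)) by lia.
rewrite !fact_simpl, !mult_INR.
replace (INR (S (n - S i))) with (INR n - INR i) by (rewrite <- minus_INR by lia; f_equal; lia).
rewrite !S_INR, plus_INR.
pose proof (INR_fact_neq_0 i). pose proof (INR_fact_neq_0 (n - S i)).
pose proof (pos_INR i). assert (INR i < INR n) by now apply lt_INR.
field. repeat split; try easy; lra.
Qed.

(* The operator [z^2 y'' + 2 z y' - n(n+1) y] applied to the tails of the coefficient
   list; the shift by [i] degrees turns it into the left-hand side below. *)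
Lemma bessel_ode_tail (n : nat) (z : Cplx) (m i : nat) : (i + S m = S n)%nat ->
  let p := bessel_list n i (S m) in
  let q := bessel_list n (S i) m in
  let ci := RtoC (INR i) in
  (z * z * ev2 p z + 2 * (ci + 1) * z * ev1 p z
   + (ci * (ci + 1) - RtoC (INR n) * (RtoC (INR n) + 1)) * ev0 p z
   = - (2 * (z * ev1 q z + (ci + 1) * ev0 q z)))%X.
Proof.
revert i; induction m; intros i Hi p q ci; unfold p, q, ci.
- replace i with n by lia. cbn. ring.
- specialize (IHm (S i) ltac:(lia)); cbv zeta in IHm.
  change (bessel_list n i (S (S m))) with
    (RtoC (bessel_coef n i) * RtoC (/ 2) ^ i :: bessel_list n (S i) (S m))%X.
  set (P := bessel_list n (S i) (S m)) in *.
  assert (HP : P = (RtoC (bessel_coef n (S i)) * RtoC (/ 2) ^ (S i) :: bessel_list n (S (S i)) m)%X)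
    by reflexivity.
  cbn [ev0 ev1 ev2].
  set (di := (RtoC (bessel_coef n i) * RtoC (/ 2) ^ i)%X).
  set (dS := (RtoC (bessel_coef n (S i)) * RtoC (/ 2) ^ S i)%X) in HP.
  set (Q := bessel_list n (S (S i)) m) in *.
  assert (Hd : ((RtoC (INR n) * (RtoC (INR n) + 1) - RtoC (INR i) * (RtoC (INR i) + 1)) * di
               = 2 * (RtoC (INR i) + 1) * dS)%X).
  { unfold di, dS. pose proof (bessel_coef_rec n i ltac:(lia)) as H.
    apply (f_equal RtoC) in H.
    rewrite !RtoC_mul, RtoC_sub, !RtoC_mul, !RtoC_add, RtoC_INR_S in H.
    cbn [Cpow]. set (h := (RtoC (/ 2) ^ i)%X).
    transitivity ((RtoC (INR i) + 1) * RtoC (bessel_coef n (S i)) * h)%X.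
    - rewrite H; ring.
    - assert (E : (2 * RtoC (/ 2) = 1)%X) by (rewrite <- RtoC_mul; f_equal; lra).
      transitivity ((2 * RtoC (/ 2)) * ((RtoC (INR i) + 1) * RtoC (bessel_coef n (S i)) * h))%X.
      + rewrite E; ring.
      + ring. }
  rewrite RtoC_INR_S in IHm.
  assert (E0 : ev0 P z = (dS + z * ev0 Q z)%X) by now rewrite HP.
  assert (E1 : ev1 P z = (ev0 Q z + z * ev1 Q z)%X) by now rewrite HP.
  set (N := RtoC (INR n)) in *. set (I := RtoC (INR i)) in *.
  set (A0 := ev0 P z) in *. set (A1 := ev1 P z) in *. set (A2 := ev2 P z) in *.
  transitivity (z * (z * z * A2 + 2 * (I + 1 + 1) * z * A1 +
       ((I + 1) * (I + 1 + 1) - N * (N + 1)) * A0)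
       - (N * (N + 1) - I * (I + 1)) * di)%X; [rewrite RtoC_2; ring|].
  rewrite IHm, Hd, E0, E1, RtoC_2. ring.
Qed.

(** At [i = 0] the right side of the tail identity is [-2 y'], because [y = b + z q] gives
    [y' = q + z q']. *)
Lemma bessel_ode (n : nat) (z : Cplx) :
  let p := bessel_list n 0 (S n) in
  (z * z * ev2 p z + 2 * (z + 1) * ev1 p z = RtoC (INR n) * (RtoC (INR n) + 1) * ev0 p z)%X.
Proof.
pose proof (bessel_ode_tail n z n 0 eq_refl) as H; cbv zeta in *.
assert (E1 : ev1 (bessel_list n 0 (S n)) z
   = (ev0 (bessel_list n 1 n) z + z * ev1 (bessel_list n 1 n) z)%X) by reflexivity.
set (p := bessel_list n 0 (S n)) in *. set (q := bessel_list n 1 n) in *.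
cbn [INR] in H. apply Csub_eq0.
transitivity (z * z * ev2 p z + 2 * (0 + 1) * z * ev1 p z +
   (0 * (0 + 1) - RtoC (INR n) * (RtoC (INR n) + 1)) * ev0 p z + 2 * ev1 p z)%X; [ring|].
rewrite H, E1; ring.
Qed.

(** The diagonal value 0 turns a sum over [j <> k] into a full [Csum]. *)
Definition Dinv (alpha : nat -> Cplx) (k j : nat) : Cplx :=
  if Nat.eqb k j then RtoC 0 else Cdiv (RtoC 1) (Csub (alpha k) (alpha j)).

Lemma lsum_filter_seq (u : nat -> Cplx) (c : nat -> bool) (n : nat) :
  lsum (map u (filter c (seq 0 n))) = Csum n (fun j => if c j then u j else 0%X).
Proof.
assert (H : forall n i, lsum (map u (filter c (seq i n)))
   = Csum n (fun j => if c (i + j)%nat then u (i + j)%nat else 0%X)).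
{ clear n; induction n; intros i; [easy|]. rewrite Csum_first. cbn [seq filter].
  rewrite Nat.add_0_r.
  rewrite (Csum_ext n _ (fun j => if c (S i + j)%nat then u (S i + j)%nat else 0%X))
    by (intros; now rewrite Nat.add_succ_comm).
  rewrite <- IHn. destruct (c i); cbn; ring. }
exact (H n O).
Qed.

Lemma bessel_list_length (n i m : nat) : length (bessel_list n i m) = m.
Proof. unfold bessel_list; now rewrite length_map, length_seq. Qed.

Lemma bessel_list_last (n : nat) : last (bessel_list n 0 (S n)) 0%X =
  (RtoC (bessel_coef n n) * RtoC (/ 2) ^ n)%X.
Proof. unfold bessel_list. rewrite seq_S, map_app. cbn [map]. now rewrite last_last. Qed.

Lemma bessel_coef_pos (n k : nat) : 0 < bessel_coef n k.
Proof.
unfold bessel_coef.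
apply Rdiv_lt_0_compat; [|apply Rmult_lt_0_compat]; apply INR_fact_lt_0.
Qed.

(** Write [y = (z - alpha_k) q]. At [alpha_k] one has [y' = q] and [y'' = 2 q'], and [q'/q] is the
    sum of the [1/(alpha_k - alpha_j)]; the differential equation is then divided by [2 q]. *)
Lemma zeros_relation (n : nat) (alpha : nat -> Cplx) (k : nat) :
  bessel_zeros n alpha -> (k < n)%nat ->
  (alpha k * alpha k * Csum n (Dinv alpha k) = - (alpha k + 1))%X.
Proof.
intros [Hr Hd] Hk.
set (p := bessel_list n 0 (S n)).
assert (Hp : exists b p', p = b :: p' /\ length p' = n).
{ eexists _, (bessel_list n 1 n). split; [reflexivity|apply bessel_list_length]. }
destruct Hp as (b & p' & Hp & Hlen).
destruct (synthetic_division p' b (alpha k)) as (q & Hl & Hlast & Hq).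
rewrite <- Hp in Hq.
assert (Hz : forall j, (j < n)%nat -> ev0 p (alpha j) = 0%X)
  by (intros j Hj; unfold p; rewrite <- bessel_y_ev0; auto).
set (others := filter (fun j => negb (Nat.eqb k j)) (seq 0 n)).
assert (Hin : forall c, In c (map alpha others) ->
   exists j, c = alpha j /\ (j < n)%nat /\ k <> j).
{ intros c Hc. apply in_map_iff in Hc as (j & <- & Hj). exists j. split; [easy|].
  apply filter_In in Hj as [Hj1 Hj2]. apply in_seq in Hj1.
  destruct (Nat.eqb_spec k j); [easy|]. split; [lia|easy]. }
assert (Hlo : S (length others) = n).
{ unfold others.
  assert (E : forall l, NoDup l -> In k l ->
     S (length (filter (fun j => negb (Nat.eqb k j)) l)) = length l).
  { induction l as [|a l IH]; [easy|]. intros Hnd Hin'. inversion Hnd; subst. cbn.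
    destruct (Nat.eqb_spec k a) as [->|Hka]; cbn.
    - f_equal. rewrite forallb_filter_id; [easy|]. apply forallb_forall. intros c Hc.
      destruct (Nat.eqb_spec a c); [now subst|easy].
    - f_equal. apply IH; [easy|]. destruct Hin'; [now subst|easy]. }
  rewrite E; [apply length_seq|apply seq_NoDup|apply in_seq; lia]. }
destruct (factor_roots (map alpha others) q) with (z := alpha k) as (F0 & F1).
- apply NoDup_map_NoDup_ForallPairs.
  + intros i j Hi Hj E. apply filter_In in Hi as [Hi _]. apply filter_In in Hj as [Hj _].
    apply in_seq in Hi, Hj. destruct (Nat.eq_dec i j) as [|Hij]; [easy|].
    now apply (Hd i j) in Hij; try lia.
  + apply NoDup_filter, seq_NoDup.
- rewrite length_map; lia.
- intros c Hc. destruct (Hin c Hc) as (j & -> & Hj & Hkj).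
  pose proof (Hz j Hj) as E. rewrite (proj1 (Hq _)), Hz in E by easy.
  destruct (Cmul_eq0 (alpha j - alpha k) (ev0 q (alpha j))) as [E'|E']; [rewrite <- E; ring| |easy].
  apply Csub_eq0 in E'. exfalso. apply (Hd j k); auto.
- assert (Hne : forall c, In c (map alpha others) -> alpha k <> c)
    by (intros c Hc; destruct (Hin c Hc) as (j & -> & Hj & Hkj); now apply Hd).
  specialize (F1 Hne).
  (* The zero is simple: this value is the leading coefficient times a product of nonzero
     differences. *)
  assert (Hq0 : ev0 q (alpha k) <> 0%X).
  { rewrite F0. intros E; apply Cmul_eq0 in E as [E|E].
    - rewrite Hlast in E by (destruct p'; [cbn in Hlen; lia|easy]).
      replace (last p' 0%X) with (last p 0%X) in E
        by (rewrite Hp; destruct p'; [cbn in Hlen; lia|easy]).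
      unfold p in E. rewrite bessel_list_last, <- RtoC_pow, <- RtoC_mul in E.
      revert E. apply RtoC_neq0. apply Rmult_integral_contrapositive_currified.
      + pose proof (bessel_coef_pos n n); lra.
      + apply pow_nonzero; lra.
    - revert E. rewrite map_map. rewrite <- (map_map alpha (fun b => alpha k - b)%X).
      apply lprod_neq0. intros c Hc E. apply Csub_eq0 in E. now apply (Hne c Hc). }
  assert (HD : lsum (map (fun b => 1 / (alpha k - b))%X (map alpha others))
     = Csum n (Dinv alpha k)).
  { rewrite map_map. unfold others. rewrite lsum_filter_seq. apply Csum_ext. intros j _.
    unfold Dinv. now destruct (Nat.eqb k j). }
  rewrite HD in F1.
  pose proof (bessel_ode n (alpha k)) as Hode; cbv zeta in Hode. fold p in Hode.
  destruct (Hq (alpha k)) as (_ & E1 & E2).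
  rewrite Hz in Hode by easy. rewrite E1, E2, F1, RtoC_2 in Hode.
  apply (Cmul_cancel_l ((1 + 1) * ev0 q (alpha k))%X).
  + intros E; apply Cmul_eq0 in E as [E|E]; [now apply Cplx_two_neq0|easy].
  + apply Csub_eq0. set (e := ev0 q (alpha k)) in *. set (s := Csum n (Dinv alpha k)) in *.
    set (a := alpha k) in *.
    transitivity (a * a * ((1 + 1) * (e * s) + (a - a) * ev2 q a)
      + (1 + 1) * (a + 1) * (e + (a - a) * (e * s)))%X; [ring|].
    rewrite Hode; ring.
Qed.

(** The factorization over all the zeros is evaluated at 0, where [y_n] equals 1. *)
Lemma bessel_zeros_prod (n : nat) (alpha : nat -> Cplx) : bessel_zeros n alpha ->
  (RtoC (bessel_coef n n) * RtoC (/ 2) ^ n * lprod (map (fun k => - alpha k) (seq 0 n)) = 1)%X.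
Proof.
intros [Hr Hd].
destruct (factor_roots (map alpha (seq 0 n)) (bessel_list n 0 (S n))) with (z := 0%X)
  as (F0 & _).
- apply NoDup_map_NoDup_ForallPairs; [|apply seq_NoDup].
  intros i j Hi Hj E. apply in_seq in Hi, Hj. destruct (Nat.eq_dec i j) as [|Hij]; [easy|].
  now apply (Hd i j) in Hij; try lia.
- now rewrite length_map, length_seq, bessel_list_length.
- intros c Hc. apply in_map_iff in Hc as (j & <- & Hj). apply in_seq in Hj.
  rewrite <- bessel_y_ev0. apply Hr; lia.
- rewrite bessel_list_last, map_map in F0.
  rewrite (map_ext _ (fun k => 0 - alpha k)%X) by (intros; ring).
  rewrite <- F0. cbn [bessel_list seq map ev0 Cpow].
  unfold bessel_coef. rewrite Nat.add_0_r, Nat.sub_0_r. cbn [fact INR].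
  replace (INR (fact n) / (INR (fact n) * 1))%R with 1%R
    by (field; apply INR_fact_neq_0). ring.
Qed.

(** * Power sums of the zeros *)

Definition psum (n : nat) (alpha : nat -> Cplx) (p : nat) : Cplx :=
  Csum n (fun k => Cpow (alpha k) p).

Lemma Cpow_diff (a b : Cplx) (p : nat) :
  (a ^ p - b ^ p = (a - b) * Csum p (fun i => a ^ i * b ^ (p - 1 - i)))%X.
Proof.
induction p; [cbn; ring|].
cbn [Csum]. replace (S p - 1 - p)%nat with O by lia.
rewrite (Csum_ext p _ (fun i => b * (a ^ i * b ^ (p - 1 - i)))%X).
- rewrite Csum_scal.
  transitivity (b * (a ^ p - b ^ p) + (a - b) * a ^ p)%X; [cbn; ring|].
  rewrite IHp. cbn [Cpow]. ring.
- intros i Hi. replace (S p - 1 - i)%nat with (S (p - 1 - i)) by lia. cbn; ring.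
Qed.

Lemma Dinv_antisym (alpha : nat -> Cplx) (k j : nat) :
  (k <> j -> alpha k <> alpha j) -> Dinv alpha j k = (- Dinv alpha k j)%X.
Proof.
unfold Dinv. rewrite (Nat.eqb_sym j k). destruct (Nat.eqb_spec k j) as [|H]; intros Hd; [ring|].
field. split; intros E; apply Csub_eq0 in E; specialize (Hd H); congruence.
Qed.

(** The sum on the right is the divided difference of [X^p]. On the diagonal the left side is 0
    while that sum has [p] equal terms, hence the correction. *)
Lemma Dinv_pow_diff (alpha : nat -> Cplx) (p k j : nat) :
  (k <> j -> alpha k <> alpha j) ->
  (alpha k ^ p * Dinv alpha k j - alpha j ^ p * Dinv alpha k j =
   Csum p (fun i => alpha k ^ i * alpha j ^ (p - 1 - i))
   - if Nat.eqb k j then RtoC (INR p) * alpha k ^ (p - 1) else 0)%X.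
Proof.
intros Hd. unfold Dinv. destruct (Nat.eqb_spec k j) as [->|H].
- rewrite (Csum_ext p _ (fun _ => alpha j ^ (p - 1))%X).
  + rewrite Csum_const; ring.
  + intros i Hi. rewrite <- Cpow_add; f_equal; lia.
- transitivity ((alpha k ^ p - alpha j ^ p) * (1 / (alpha k - alpha j)))%X; [ring|].
  rewrite Cpow_diff. field. intros E; apply Csub_eq0 in E; now apply Hd.
Qed.

(** Exchanging [k] and [j] changes the sign of [Dinv], so twice the double sum is the sum over all
    pairs of [(alpha_k^p - alpha_j^p)/(alpha_k - alpha_j)], which expands into monomials in
    [alpha_k] and [alpha_j]. *)
Lemma psum_convolution (n : nat) (alpha : nat -> Cplx) (p : nat) :
  (forall i j, (i < n)%nat -> (j < n)%nat -> i <> j -> alpha i <> alpha j) ->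
  (2 * Csum n (fun k => alpha k ^ p * Csum n (Dinv alpha k)) =
   Csum p (fun i => psum n alpha i * psum n alpha (p - 1 - i))
   - RtoC (INR p) * psum n alpha (p - 1))%X.
Proof.
intros Hd.
assert (E1 : Csum n (fun k => alpha k ^ p * Csum n (Dinv alpha k))%X =
  Csum n (fun k => Csum n (fun j => alpha k ^ p * Dinv alpha k j))%X)
  by (apply Csum_ext; intros; now rewrite Csum_scal).
assert (E2 : Csum n (fun k => alpha k ^ p * Csum n (Dinv alpha k))%X =
  (0 - Csum n (fun k => Csum n (fun j => alpha j ^ p * Dinv alpha k j)))%X).
{ rewrite E1, Csum_exchange. rewrite <- (Csum_0 n (fun _ => 0%X)) by easy.
  rewrite <- Csum_sub. apply Csum_ext; intros j Hj.
  rewrite <- (Csum_0 n (fun _ => 0%X)) at 1 by easy.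
  rewrite <- Csum_sub. apply Csum_ext; intros k Hk.
  rewrite (Dinv_antisym alpha j k) by (intros; apply Hd; auto). ring. }
transitivity (Csum n (fun k => alpha k ^ p * Csum n (Dinv alpha k))
  + Csum n (fun k => alpha k ^ p * Csum n (Dinv alpha k)))%X; [rewrite RtoC_2; ring|].
rewrite E2 at 2. rewrite E1.
transitivity (Csum n (fun k => Csum n (fun j =>
  alpha k ^ p * Dinv alpha k j - alpha j ^ p * Dinv alpha k j)))%X.
{ rewrite (Csum_ext n (fun k => Csum n (fun j =>
    alpha k ^ p * Dinv alpha k j - alpha j ^ p * Dinv alpha k j))%X
    (fun k => Csum n (fun j => alpha k ^ p * Dinv alpha k j)
      - Csum n (fun j => alpha j ^ p * Dinv alpha k j))%X) by (intros; apply Csum_sub).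
  rewrite Csum_sub; ring. }
rewrite (Csum_ext n _ (fun k => Csum n (fun j =>
   Csum p (fun i => alpha k ^ i * alpha j ^ (p - 1 - i)))
   - RtoC (INR p) * alpha k ^ (p - 1)))%X.
- rewrite Csum_sub, Csum_scal. f_equal.
  rewrite (Csum_ext n _ (fun k => Csum p (fun i => alpha k ^ i * psum n alpha (p - 1 - i))%X)).
  + rewrite Csum_exchange. apply Csum_ext; intros i Hi. unfold psum at 2.
    rewrite (Csum_ext n _ (fun k => psum n alpha (p - 1 - i) * alpha k ^ i)%X)
      by (intros; ring). rewrite Csum_scal; ring.
  + intros k Hk. rewrite Csum_exchange. apply Csum_ext; intros i Hi. now rewrite Csum_scal.
- intros k Hk. rewrite (Csum_ext n _ (fun j =>
   Csum p (fun i => alpha k ^ i * alpha j ^ (p - 1 - i))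
   - if Nat.eqb k j then RtoC (INR p) * alpha k ^ (p - 1) else 0)%X)
    by (intros; apply Dinv_pow_diff; auto).
  now rewrite Csum_sub, Csum_delta.
Qed.

(** The relation at [alpha_k] is multiplied by [alpha_k^m] and summed; its factor [alpha_k^2] is why
    the convolution is taken at exponent [m + 2]. *)
Lemma psum_rec (n : nat) (alpha : nat -> Cplx) (m : nat) : bessel_zeros n alpha ->
  (- (2 * (psum n alpha (S m) + psum n alpha m)) =
   Csum (S (S m)) (fun i => psum n alpha i * psum n alpha (S m - i))
   - RtoC (INR (S (S m))) * psum n alpha (S m))%X.
Proof.
intros Hz. pose proof (psum_convolution n alpha (S (S m)) (proj2 Hz)) as H.
replace (S (S m) - 1)%nat with (S m) in H by lia. rewrite <- H.
rewrite (Csum_ext n _ (fun k => 0 - (alpha k ^ S m + alpha k ^ m))%X).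
- rewrite Csum_sub, Csum_add, (Csum_0 n (fun _ => 0%X)) by easy. unfold psum; ring.
- intros k Hk. pose proof (zeros_relation n alpha k Hz Hk) as E.
  transitivity (alpha k ^ m * (alpha k * alpha k * Csum n (Dinv alpha k)))%X;
    [cbn; ring|]. rewrite E. cbn; ring.
Qed.

Notation odd_psum n alpha M := (psum n alpha (2 * M + 1)).
Notation even_psum n alpha M := (psum n alpha (2 * M)).

Lemma psum_0 (n : nat) (alpha : nat -> Cplx) : psum n alpha 0 = RtoC (INR n).
Proof. unfold psum; cbn [Cpow]. rewrite Csum_const; ring. Qed.

(** The indices in the convolution add up to the odd number [2M + 1], so every product pairs an odd
    with an even index. The two parity classes give the same sum, and a factor 2 is divided out. *)
Lemma psum_odd_rec (n : nat) (alpha : nat -> Cplx) (M : nat) : bessel_zeros n alpha ->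
  (RtoC (INR M) * odd_psum n alpha M - even_psum n alpha M =
   Csum (S M) (fun a => odd_psum n alpha a * even_psum n alpha (M - a)))%X.
Proof.
intros Hz. pose proof (psum_rec n alpha (2 * M) Hz) as H.
replace (S (S (2 * M))) with (2 * S M)%nat in H by lia.
rewrite Csum_even_odd in H.
rewrite <- (Csum_rev (S M) (fun i => psum n alpha (2 * i) * psum n alpha (S (2 * M) - 2 * i)))%X in H.
rewrite (Csum_ext (S M) (fun i => psum n alpha (2 * (S M - 1 - i)) *
    psum n alpha (S (2 * M) - 2 * (S M - 1 - i)))%X
   (fun a => odd_psum n alpha a * even_psum n alpha (M - a))%X) in H.
2:{ intros a Ha. rewrite Cmul_comm. f_equal; f_equal; lia. }
rewrite (Csum_ext (S M) (fun i => psum n alpha (2 * i + 1) *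
    psum n alpha (S (2 * M) - (2 * i + 1)))%X
   (fun a => odd_psum n alpha a * even_psum n alpha (M - a))%X) in H.
2:{ intros a Ha. f_equal; f_equal; lia. }
set (s := Csum (S M) (fun a => odd_psum n alpha a * even_psum n alpha (M - a))%X) in *.
replace (S (2 * M)) with (2 * M + 1)%nat in H by lia.
rewrite mult_INR, RtoC_mul, (RtoC_INR_S M) in H. change (INR 2) with 2 in H.
apply (Cmul_cancel_l (1 + 1)%X); [apply Cplx_two_neq0|].
apply Csub_eq0. rewrite RtoC_2 in H.
transitivity (- (((1 + 1) * (odd_psum n alpha M + even_psum n alpha M))) - (s + s -
   (1 + 1) * (RtoC (INR M) + 1) * odd_psum n alpha M))%X; [ring|].
rewrite H. ring.
Qed.

Lemma psum_1 (n : nat) (alpha : nat -> Cplx) : (0 < n)%nat -> bessel_zeros n alpha ->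
  psum n alpha 1 = (- (1))%X.
Proof.
intros Hn Hz. pose proof (psum_odd_rec n alpha 0 Hz) as H. cbn [Csum INR Nat.mul Nat.add Nat.sub] in H.
rewrite psum_0 in H.
apply (Cmul_cancel_l (RtoC (INR n))).
- apply RtoC_neq0, not_0_INR; lia.
- transitivity (0 + psum n alpha 1 * RtoC (INR n))%X; [ring|]. rewrite <- H. ring.
Qed.

Lemma psum_2 (n : nat) (alpha : nat -> Cplx) : (0 < n)%nat -> bessel_zeros n alpha ->
  psum n alpha 2 = RtoC (/ (2 * INR n - 1)).
Proof.
intros Hn Hz. pose proof (psum_rec n alpha 1 Hz) as H.
cbn [Csum Nat.sub] in H. rewrite psum_1, psum_0 in H by easy.
assert (H0 : 1 <= INR n) by (apply (le_INR 1); lia).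
apply (Cmul_cancel_l (RtoC (2 * INR n - 1))); [apply RtoC_neq0; lra|].
rewrite <- RtoC_mul, Rinv_r by lra.
rewrite !RtoC_INR_S in H. cbn [INR] in H. rewrite RtoC_sub, RtoC_mul, RtoC_2 in *.
apply Csub_eq0. set (N := RtoC (INR n)) in *. set (s := psum n alpha 2) in *.
transitivity (- (- ((1 + 1) * (s + - (1))) - (0 + N * s + - (1) * - (1) + s * N
   - (0 + 1 + 1 + 1) * s)))%X; [ring|].
rewrite H. ring.
Qed.

(** Since [S_1 = -1], the term [a = 0] cancels the lone even sum, and the last term brings [S_0 = n]
    to the left. *)
Lemma psum_odd_rec' (n : nat) (alpha : nat -> Cplx) (M : nat) :
  (0 < n)%nat -> bessel_zeros n alpha ->
  ((RtoC (INR (S M)) - RtoC (INR n)) * odd_psum n alpha (S M) =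
   Csum M (fun a => odd_psum n alpha (S a) * even_psum n alpha (M - a)))%X.
Proof.
intros Hn Hz. pose proof (psum_odd_rec n alpha (S M) Hz) as H.
rewrite Csum_first in H. cbn [Nat.sub] in H.
change (2 * 0 + 1)%nat with 1%nat in H. rewrite (psum_1 n alpha Hn Hz) in H.
cbn [Csum] in H. rewrite Nat.sub_diag in H. rewrite psum_0 in H.
transitivity (RtoC (INR (S M)) * odd_psum n alpha (S M) - even_psum n alpha (S M) + even_psum n alpha (S M)
  - RtoC (INR n) * odd_psum n alpha (S M))%X; [ring|].
rewrite H. ring.
Qed.

Lemma psum_odd_0 (n : nat) (alpha : nat -> Cplx) (M : nat) :
  bessel_zeros n alpha -> (S M < n)%nat -> odd_psum n alpha (S M) = 0%X.
Proof.
intros Hz. induction M as [M IH] using lt_wf_ind; intros HM.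
assert (Hn : (0 < n)%nat) by lia.
pose proof (psum_odd_rec' n alpha M Hn Hz) as H.
rewrite Csum_0 in H by (intros a Ha; rewrite IH by lia; ring).
apply Cmul_eq0 in H as [H|H]; [|easy]. apply Csub_eq0, RtoC_inj, INR_eq in H. lia.
Qed.

(** The odd sums strictly between [S_1] and [S_(2n+1)] vanish, so the right side starts at
    [S_(2n+1)]. It stops at [l = j - 1], which determines [odd_psum n alpha (n + j)] from its
    predecessors for every [j > 0]. *)
Lemma psum_odd_tail (n : nat) (alpha : nat -> Cplx) (j : nat) :
  (0 < n)%nat -> bessel_zeros n alpha ->
  (RtoC (INR j) * odd_psum n alpha (n + j) =
   Csum j (fun l => odd_psum n alpha (n + l) * even_psum n alpha (j - l)))%X.
Proof.
intros Hn Hz. destruct n as [|n']; [lia|]. cbn [Nat.add].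
pose proof (psum_odd_rec' (S n') alpha (n' + j) Hn Hz) as H.
rewrite <- RtoC_sub, <- minus_INR in H by lia.
replace (S (n' + j) - S n')%nat with j in H by lia. rewrite H, Csum_split.
rewrite Csum_0.
- transitivity (Csum j (fun i => odd_psum (S n') alpha (S (n' + i)) * even_psum (S n') alpha (n' + j - (n' + i)))%X);
    [ring|]. apply Csum_ext; intros l Hl. do 2 f_equal. lia.
- intros i Hi. rewrite psum_odd_0 by (easy || lia). ring.
Qed.

(** * Size of the zeros and of the power sums *)

Lemma Rsum_skip (N k : nat) (c : R) : (k < N)%nat ->
  Rsum N (fun j => if Nat.eqb k j then 0 else c) = (INR N - 1) * c.
Proof.
induction N; [lia|]; intros H. cbn [Rsum]. rewrite S_INR.
destruct (Nat.eqb_spec k N) as [->|Hk].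
- assert (E : forall M, (M <= N)%nat ->
    Rsum M (fun j => if Nat.eqb N j then 0 else c) = INR M * c).
  { induction M; intros HM; [cbn; ring|]. cbn [Rsum]. rewrite IHM, S_INR by lia.
    destruct (Nat.eqb_spec N M); [lia|ring]. }
  rewrite E by lia. ring.
- rewrite IHN by lia. ring.
Qed.

Lemma exists_max_norm (n : nat) (u : nat -> Cplx) : (0 < n)%nat ->
  exists k, (k < n)%nat /\ forall j, (j < n)%nat -> Cnorm (u j) <= Cnorm (u k).
Proof.
induction n as [|n IH]; [lia|]; intros _. destruct n as [|n].
- exists O. split; [lia|]. intros j Hj. replace j with O by lia. lra.
- destruct IH as (k & Hk & H); [lia|].
  destruct (Rle_dec (Cnorm (u (S n))) (Cnorm (u k))) as [L|L].
  + exists k. split; [lia|]. intros j Hj.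
    destruct (Nat.eq_dec j (S n)); [now subst|apply H; lia].
  + exists (S n). split; [lia|]. intros j Hj.
    destruct (Nat.eq_dec j (S n)); [subst; lra|].
    apply Rle_trans with (Cnorm (u k)); [apply H; lia|lra].
Qed.

(** Multiplied by [2 |a - b|^2], the difference of the two sides is [|a|^2 - |b|^2]. *)
Lemma Re_div_sub_ge_half (a b : Cplx) : a <> b -> Cnorm b <= Cnorm a ->
  1 / 2 <= fst (a * (1 / (a - b)))%X.
Proof.
intros Hab Hn.
assert (Hs : Cnorm b ^ 2 <= Cnorm a ^ 2) by (apply pow_incr; split; [apply Cnorm_ge0|easy]).
rewrite !Cnorm_sq in Hs.
assert (Hd : 0 < Cnorm (a - b) ^ 2).
{ apply pow_lt, Cnorm_gt0. intros E; now apply Hab, Csub_eq0. }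
rewrite Cnorm_sq in Hd. destruct a as [s t], b as [p q]. cbn [fst snd] in *.
unfold Cdiv, Cinv, Csub, Copp, Cadd, Cmul, RtoC in *. cbn [fst snd] in *.
set (N := (s + - p) ^ 2 + (t + - q) ^ 2) in *.
match goal with |- _ <= ?x => replace x with ((s * (s - p) + t * (t - q)) / N) by (field; lra) end.
apply Rmult_le_reg_r with N; [easy|].
unfold Rdiv at 2. rewrite Rmult_assoc, Rinv_l by lra. unfold N; nra.
Qed.

(* At a zero [a] of maximal modulus every [a/(a-b)] has real part at least 1/2, while by
   the differential equation these numbers add up to [-1-1/a]. *)
Lemma bessel_zeros_bound (n : nat) (alpha : nat -> Cplx) (k : nat) :
  bessel_zeros n alpha -> (k < n)%nat -> Cnorm (alpha k) <= 2 / (INR n + 1).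
Proof.
intros Hz Hk.
destruct (exists_max_norm n alpha ltac:(lia)) as (m & Hm & Hmax).
eapply Rle_trans; [apply Hmax, Hk|].
pose proof (zeros_relation n alpha m Hz Hm) as H.
set (a := alpha m) in *. set (w := (a * Csum n (Dinv alpha m))%X).
assert (E : (a * (w + 1) = - (1))%X).
{ apply Csub_eq0. unfold w.
  transitivity (a * a * Csum n (Dinv alpha m) - - (a + 1))%X; [ring|rewrite H; ring]. }
assert (Hw : (INR n - 1) * (1 / 2) <= fst w).
{ unfold w. rewrite <- Csum_scal, fst_Csum, <- (Rsum_skip n m) by easy.
  apply Rsum_le. intros j Hj. unfold Dinv. destruct (Nat.eqb_spec m j) as [Hmj|Hmj].
  - cbn; lra.
  - apply Re_div_sub_ge_half; [apply Hz; auto|apply Hmax, Hj]. }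
pose proof (fst_le_Cnorm (w + 1)) as Hf. cbn [Cadd RtoC fst] in Hf.
pose proof (Rle_abs (fst w + 1)).
assert (N1 : Cnorm a * Cnorm (w + 1) = 1).
{ rewrite <- Cnorm_mul, E, Cnorm_opp, Cnorm_RtoC_pos; lra. }
pose proof (pos_INR n). pose proof (Cnorm_ge0 a).
apply Rmult_le_reg_r with (INR n + 1); [lra|].
unfold Rdiv; rewrite Rmult_assoc, Rinv_l by lra. nra.
Qed.

Lemma psum_norm_le (n : nat) (alpha : nat -> Cplx) (p : nat) : bessel_zeros n alpha ->
  Cnorm (psum n alpha p) <= INR n * (2 / (INR n + 1)) ^ p.
Proof.
intros Hz. eapply Rle_trans; [apply Cnorm_Csum_le|].
rewrite <- Rsum_const. apply Rsum_le. intros k Hk.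
rewrite Cnorm_pow. apply pow_incr. split; [apply Cnorm_ge0|now apply bessel_zeros_bound].
Qed.

(** Bounds for the even sums in units of [r^i], [r = 2/(n+1)]. At [i = 1] they use the exact value
    [1/(2n-1)], with [7/25] attained at [n = 13]. For [i >= 2] the crude estimate
    [n r^(2i) <= 2 r^(i-1) r^i] with [r <= 1/7] is enough; at [i = 1] it would give the weight 2,
    too large for a total of 1. *)
Definition even_weight (i : nat) : R := if Nat.eqb i 1 then 7 / 25 else 2 * (1 / 7) ^ (i - 1).

Lemma psum_even_le (n : nat) (alpha : nat -> Cplx) (i : nat) :
  (13 <= n)%nat -> bessel_zeros n alpha -> (0 < i)%nat ->
  Cnorm (psum n alpha (2 * i)) <= even_weight i * (2 / (INR n + 1)) ^ i.
Proof.
intros Hn Hz Hi. assert (Hn' : 13 <= INR n) by (replace 13 with (INR 13) by (cbn; ring); now apply le_INR).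
unfold even_weight. destruct (Nat.eqb_spec i 1) as [->|Hi1].
- change (2 * 1)%nat with 2%nat. rewrite psum_2 by (easy || lia).
  assert (0 < / (2 * INR n - 1)) by (apply Rinv_0_lt_compat; lra).
  rewrite Cnorm_RtoC_pos by lra.
  apply Rmult_le_reg_r with ((2 * INR n - 1) * (INR n + 1)); [nra|].
  transitivity (INR n + 1); [right; field; lra|].
  transitivity (14 / 25 * (2 * INR n - 1)); [lra|right; field; lra].
- eapply Rle_trans; [now apply psum_norm_le|].
  set (r := 2 / (INR n + 1)).
  assert (Hr : 0 < r) by (apply Rdiv_lt_0_compat; lra).
  assert (Hnr : INR n * r <= 2).
  { unfold r. apply Rmult_le_reg_r with (INR n + 1); [lra|].
    transitivity (2 * INR n); [right; field; lra|lra]. }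
  assert (Hr7 : r <= 1 / 7).
  { unfold r. apply Rmult_le_reg_r with (INR n + 1); [lra|].
    transitivity 2; [right; field; lra|lra]. }
  replace (2 * i)%nat with (i + i)%nat by lia. rewrite pow_add, <- Rmult_assoc.
  apply Rmult_le_compat_r; [apply pow_le; lra|].
  destruct i as [|i]; [lia|]. cbn [pow]. rewrite <- Rmult_assoc.
  replace (S i - 1)%nat with i by lia.
  apply Rmult_le_compat; [|apply pow_le; lra|easy|apply pow_incr; lra].
  apply Rmult_le_pos; lra.
Qed.

Lemma Rsum_first (N : nat) (u : nat -> R) :
  Rsum (S N) u = u O + Rsum N (fun i => u (S i)).
Proof.
induction N; [cbn; ring|].
change (Rsum (S (S N)) u) with (Rsum (S N) u + u (S N)). rewrite IHN; cbn; ring.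
Qed.

Lemma even_weight_sum (j : nat) : Rsum j (fun l => even_weight (j - l)) <= 1.
Proof.
(* The weights of index 2 to [j + 1] add up to [1/3 - 1/3 (1/7)^j], and [7/25 + 1/3 < 62/100]. *)
assert (H : forall j, Rsum (S j) (fun l => even_weight (S j - l)) <= 62 / 100 - 1 / 3 * (1 / 7) ^ j).
{ clear j; induction j as [|j IH].
  - unfold even_weight; cbn; lra.
  - rewrite Rsum_first. cbn [Nat.sub] in *.
    replace (even_weight (S (S j))) with (2 * (1 / 7) ^ S j) by reflexivity.
    cbn [pow]. lra. }
destruct j as [|j]; [cbn; lra|]. specialize (H j).
pose proof (pow_le (1 / 7) j ltac:(lra)). lra.
Qed.

(** Strong induction: in the tail recurrence the powers [r^l] and [r^(j-l)] combine to [r^j], the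
    weights add up to at most 1, and the left side carries a factor [j >= 1]. *)
Lemma psum_odd_tail_le (n : nat) (alpha : nat -> Cplx) (j : nat) :
  (13 <= n)%nat -> bessel_zeros n alpha ->
  Cnorm (psum n alpha (2 * (n + j) + 1)) <=
  (2 / (INR n + 1)) ^ j * Cnorm (psum n alpha (2 * n + 1)).
Proof.
intros Hn Hz. induction j as [j IH] using lt_wf_ind.
set (r := 2 / (INR n + 1)) in *. set (On := Cnorm (psum n alpha (2 * n + 1))) in *.
assert (Hr : 0 <= r) by (pose proof (pos_INR n); apply Rdiv_le_0_compat; lra).
assert (HO : 0 <= On) by apply Cnorm_ge0.
destruct (Nat.eq_dec j 0) as [->|Hj].
- rewrite Nat.add_0_r. cbn [pow]. fold On. lra.
- pose proof (psum_odd_tail n alpha j ltac:(lia) Hz) as H.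
  assert (H1 : INR j * Cnorm (psum n alpha (2 * (n + j) + 1)) <= r ^ j * On).
  { rewrite <- (Cnorm_RtoC_pos (INR j)) by apply pos_INR.
    rewrite <- Cnorm_mul, H. eapply Rle_trans; [apply Cnorm_Csum_le|].
    apply Rle_trans with (Rsum j (fun l => (r ^ j * On) * even_weight (j - l))).
    - apply Rsum_le. intros l Hl. rewrite Cnorm_mul.
      apply Rle_trans with ((r ^ l * On) * (even_weight (j - l) * r ^ (j - l))).
      + apply Rmult_le_compat; try apply Cnorm_ge0; [now apply IH|].
        apply psum_even_le; (easy || lia).
      + right. replace (r ^ j) with (r ^ l * r ^ (j - l)) by (rewrite <- pow_add; f_equal; lia).
        ring.
    - rewrite Rsum_scal. rewrite <- (Rmult_1_r (r ^ j * On)) at 2.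
      apply Rmult_le_compat_l; [|apply even_weight_sum].
      apply Rmult_le_pos; [now apply pow_le|easy]. }
  assert (1 <= INR j) by (apply (le_INR 1); lia).
  pose proof (Cnorm_ge0 (psum n alpha (2 * (n + j) + 1))). nra.
Qed.

Fixpoint Cprod (N : nat) (u : nat -> Cplx) : Cplx :=
  match N with O => RtoC 1 | S N' => Cmul (Cprod N' u) (u N') end.
Fixpoint Rprod (N : nat) (u : nat -> R) : R :=
  match N with O => 1 | S N' => Rprod N' u * u N' end.

Lemma lprod_map_seq (N : nat) (u : nat -> Cplx) : lprod (map u (seq 0 N)) = Cprod N u.
Proof.
assert (E : forall l a, lprod (l ++ a :: nil) = (lprod l * a)%X)
  by (induction l; intros; cbn; [ring|rewrite IHl; ring]).
induction N; [easy|]. rewrite seq_S, map_app. cbn [map]. now rewrite E, IHN.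
Qed.
Lemma Cnorm_Cprod (N : nat) (u : nat -> Cplx) :
  Cnorm (Cprod N u) = Rprod N (fun k => Cnorm (u k)).
Proof.
induction N; cbn [Cprod Rprod]; [apply Cnorm_RtoC_pos; lra|now rewrite Cnorm_mul, IHN].
Qed.
Lemma Cprod_eq0 (N : nat) (u : nat -> Cplx) (k : nat) :
  (k < N)%nat -> u k = 0%X -> Cprod N u = 0%X.
Proof.
induction N; [lia|]; intros Hk E. cbn. destruct (Nat.eq_dec k N) as [->|].
- rewrite E; ring.
- rewrite IHN by (easy || lia); ring.
Qed.
Lemma Rprod_ext (N : nat) (u v : nat -> R) :
  (forall k, (k < N)%nat -> u k = v k) -> Rprod N u = Rprod N v.
Proof. induction N; cbn; [easy|]; intros H. rewrite IHN, H; auto with arith. Qed.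
Lemma Rprod_mul (N : nat) (u v : nat -> R) :
  Rprod N (fun k => u k * v k) = Rprod N u * Rprod N v.
Proof. induction N; cbn; [|rewrite IHN]; ring. Qed.

Lemma Cprod_expand (beta : nat -> Cplx) (n : nat) : exists d : nat -> Cplx,
  d n = 1%X /\ d O = Cprod n (fun k => - beta k)%X /\
  forall X, Csum (S n) (fun i => d i * X ^ i)%X = Cprod n (fun k => X - beta k)%X.
Proof.
induction n as [|n (d & Hn & H0 & H)].
- exists (fun _ => 1%X). repeat split. intros X; cbn; ring.
(* Multiplication by [X - beta n]; the test [i <= n] cuts off the values of [d] above its degree,
   about which nothing is known. *)
- exists (fun i => (match i with O => 0 | S i' => d i' end)
             - beta n * (if Nat.leb i n then d i else 0))%X.
  split; [|split].
  + destruct (Nat.leb_spec (S n) n); [lia|]. cbn beta iota. rewrite Hn; ring.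
  + cbn. rewrite H0; ring.
  + intros X. cbn [Cprod]. rewrite <- H.
    rewrite (Csum_ext (S (S n)) _ (fun i => match i with O => 0 | S i' => d i' end * X ^ i
      - beta n * ((if Nat.leb i n then d i else 0) * X ^ i))%X) by (intros; ring).
    rewrite Csum_sub, Csum_scal.
    rewrite Csum_first.
    change (Csum (S (S n)) (fun i => (if Nat.leb i n then d i else 0) * X ^ i)%X) with
     (Csum (S n) (fun i => (if Nat.leb i n then d i else 0) * X ^ i) +
       (if Nat.leb (S n) n then d (S n) else 0) * X ^ (S n))%X.
    destruct (Nat.leb_spec (S n) n); [lia|].
    rewrite (Csum_ext (S n) (fun i => (if Nat.leb i n then d i else 0) * X ^ i)%X
      (fun i => d i * X ^ i)%X).
    2:{ intros i Hi. destruct (Nat.leb_spec i n); [easy|lia]. }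
    rewrite (Csum_ext (S n) (fun i => d i * X ^ S i)%X (fun i => X * (d i * X ^ i))%X)
      by (intros; cbn; ring).
    rewrite Csum_scal. cbn [Cpow]. ring.
Qed.

Lemma odd_psum_eq (n : nat) (alpha : nat -> Cplx) (i : nat) :
  psum n alpha (2 * i + 1) = Csum n (fun k => alpha k * (alpha k * alpha k) ^ i)%X.
Proof.
apply Csum_ext; intros k _. rewrite Cpow_sq, Cpow_add. cbn [Cpow]; ring.
Qed.

(** Let [d] be the coefficients of the polynomial whose roots are the [alpha_k^2]. Summing [alpha_k]
    times its value at [alpha_k^2] shows that the odd sums [S_(2i+1)], weighted by [d_i], add up to
    0. Only [i = 0] and [i = n] survive, so [S_(2n+1) = -d_0 S_1 = d_0]. *)
Lemma psum_first_odd (n : nat) (alpha : nat -> Cplx) : (0 < n)%nat -> bessel_zeros n alpha ->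
  psum n alpha (2 * n + 1) = Cprod n (fun k => - (alpha k * alpha k))%X.
Proof.
intros Hn Hz. destruct (Cprod_expand (fun k => alpha k * alpha k)%X n) as (d & Hdn & Hd0 & Hd).
rewrite <- Hd0.
assert (E : Csum (S n) (fun i => d i * psum n alpha (2 * i + 1))%X = 0%X).
{ rewrite (Csum_ext (S n) _
    (fun i => Csum n (fun k => alpha k * (d i * (alpha k * alpha k) ^ i)))%X).
  - rewrite Csum_exchange. apply Csum_0. intros k Hk.
    rewrite Csum_scal, Hd, (Cprod_eq0 n _ k) by (easy || ring). ring.
  - intros i _. rewrite odd_psum_eq, <- Csum_scal. apply Csum_ext; intros; ring. }
destruct n as [|n]; [lia|].
change (Csum (S (S n)) (fun i => d i * psum (S n) alpha (2 * i + 1))%X) with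
  (Csum (S n) (fun i => d i * psum (S n) alpha (2 * i + 1)) + d (S n) * psum (S n) alpha (2 * S n + 1))%X in E.
rewrite Csum_first in E. change (2 * 0 + 1)%nat with 1%nat in E.
rewrite psum_1, Hdn in E by easy. rewrite Csum_0 in E.
- apply Csub_eq0. rewrite <- E. ring.
- intros i Hi. rewrite psum_odd_0 by (easy || lia). ring.
Qed.

Lemma Cnorm_psum_first_odd (n : nat) (alpha : nat -> Cplx) :
  (0 < n)%nat -> bessel_zeros n alpha ->
  Cnorm (psum n alpha (2 * n + 1)) = 4 ^ n * factor_n n.
Proof.
intros Hn Hz. rewrite psum_first_odd, Cnorm_Cprod by easy.
rewrite (Rprod_ext n _ (fun k => Cnorm (- alpha k) * Cnorm (- alpha k)))
  by (intros; now rewrite !Cnorm_opp, Cnorm_mul).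
rewrite Rprod_mul, <- Cnorm_Cprod, <- lprod_map_seq.
pose proof (bessel_zeros_prod n alpha Hz) as H. apply (f_equal Cnorm) in H.
rewrite !Cnorm_mul, Cnorm_pow, !Cnorm_RtoC_pos in H; try lra.
2:{ left; apply bessel_coef_pos. }
set (L := Cnorm (lprod (map (fun k => - alpha k)%X (seq 0 n)))) in *.
unfold bessel_coef in H. rewrite Nat.sub_diag in H. cbn [fact INR] in H.
replace (n + n)%nat with (2 * n)%nat in H by lia.
pose proof (INR_fact_neq_0 n) as F1. pose proof (INR_fact_neq_0 (2 * n)) as F2.
assert (HL : L = 2 ^ n * INR (fact n) / INR (fact (2 * n))).
{ pose proof (pow_lt 2 n ltac:(lra)).
  rewrite <- (Rmult_1_r (2 ^ n * _ / _)), <- H, pow_inv. field. repeat split; lra. }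
rewrite HL. unfold factor_n. replace 4 with (2 * 2) by ring. rewrite Rpow_mult_distr. field.
easy.
Qed.

(** Let [P] be the product. Each [(P(X) - P(b))/(X - b)] with [b = alpha_k^2] is a polynomial in
    [X]; weighted by [alpha_k] and summed, it involves only odd power sums of index below [2n], all
    0 except [S_1 = -1]. So [P] times the inner sum is [-(P(X) - d_0)/X], and what remains is
    [d_0 = S_(2n+1)]. *)
Lemma psum_resolvent (n : nat) (alpha : nat -> Cplx) (X : Cplx) :
  (0 < n)%nat -> bessel_zeros n alpha ->
  (forall k, (k < n)%nat -> X <> (alpha k * alpha k)%X) ->
  (Cprod n (fun k => X - alpha k * alpha k) *
     (1 + X * Csum n (fun k => alpha k / (X - alpha k * alpha k)))
   = psum n alpha (2 * n + 1))%X.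
Proof.
intros Hn Hz HX. rewrite psum_first_odd by easy.
destruct (Cprod_expand (fun k => alpha k * alpha k)%X n) as (d & Hdn & Hd0 & Hd).
rewrite <- Hd0, <- Hd.
assert (E : (Csum (S n) (fun i => d i * X ^ i) *
    Csum n (fun k => alpha k / (X - alpha k * alpha k)) =
    Csum (S n) (fun i => d i * Csum i (fun l => X ^ l * psum n alpha (2 * (i - 1 - l) + 1))))%X).
{ rewrite <- Csum_scal.
  rewrite (Csum_ext n _ (fun k => Csum (S n) (fun i => d i * Csum i (fun l =>
     X ^ l * (alpha k * (alpha k * alpha k) ^ (i - 1 - l)))))%X).
  - rewrite Csum_exchange. apply Csum_ext; intros i _. rewrite Csum_scal. f_equal.
    rewrite Csum_exchange. apply Csum_ext; intros l _.
    now rewrite Csum_scal, odd_psum_eq.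
  - intros k Hk. set (b := (alpha k * alpha k)%X).
    assert (Hb : (X - b)%X <> 0%X) by (intros E; apply Csub_eq0 in E; now apply (HX k)).
    transitivity ((Csum (S n) (fun i => d i * X ^ i) - Csum (S n) (fun i => d i * b ^ i)) *
      (alpha k / (X - b)))%X.
    + rewrite (Hd b), (Cprod_eq0 n _ k) by (easy || (unfold b; ring)). ring.
    + rewrite <- Csum_sub, Cmul_comm, <- Csum_scal. apply Csum_ext; intros i _.
      rewrite (Csum_ext i (fun l => X ^ l * (alpha k * b ^ (i - 1 - l)))%X
        (fun l => alpha k * (X ^ l * b ^ (i - 1 - l)))%X) by (intros; ring).
      rewrite Csum_scal.
      transitivity (alpha k / (X - b) * d i * (X ^ i - b ^ i))%X; [ring|].
      rewrite Cpow_diff. field. easy. }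
transitivity (Csum (S n) (fun i => d i * X ^ i) + X * (Csum (S n) (fun i => d i * X ^ i) *
    Csum n (fun k => alpha k / (X - alpha k * alpha k))))%X; [ring|].
rewrite E, !Csum_first.
rewrite (Csum_ext n (fun i => d (S i) * Csum (S i) (fun l => X ^ l * psum n alpha (2 * (S i - 1 - l) + 1)))%X
   (fun i => - (1) * (d (S i) * X ^ i))%X).
- rewrite Csum_scal. rewrite (Csum_ext n (fun i => d (S i) * X ^ S i)%X
    (fun i => X * (d (S i) * X ^ i))%X) by (intros; cbn; ring).
  rewrite Csum_scal. cbn [Csum Cpow]. ring.
- intros i Hi. cbn [Csum]. rewrite Csum_0.
  + replace (2 * (S i - 1 - i) + 1)%nat with 1%nat by lia. rewrite psum_1 by easy. ring.
  + intros l Hl. replace (S i - 1 - l)%nat with (S (i - l - 1)) by lia.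
    rewrite psum_odd_0 by (easy || lia). ring.
Qed.

(** * Taylor coefficients of the remainder *)

Fixpoint bin (m i : nat) : R :=
  match i, m with
  | O, _ => 1
  | S _, O => 0
  | S i', S m' => bin m' i' + bin m' i
  end.

Lemma bin_ge0 (m i : nat) : 0 <= bin m i.
Proof.
revert i; induction m; intros [|i]; cbn; try lra.
pose proof (IHm i); pose proof (IHm (S i)); lra.
Qed.
Lemma bin_0_r (m : nat) : bin m 0 = 1.
Proof. now destruct m. Qed.
Lemma bin_1 (m : nat) : bin m 1 = INR m.
Proof.
induction m; [easy|]. rewrite S_INR, <- IHm.
change (bin (S m) 1) with (bin m 0 + bin m 1). rewrite bin_0_r; ring.
Qed.
Lemma bin_small (m i : nat) : (m < i)%nat -> bin m i = 0.
Proof.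
revert i; induction m; intros [|i] H; try lia; cbn; [easy|].
rewrite !IHm by lia; ring.
Qed.

(* A single term of [sum_m bin m p x^m = x^p / (1-x)^(p+1)]. *)
Lemma bin_pow_le (x : R) (m p : nat) : 0 < x < 1 ->
  bin m p * x ^ m <= x ^ p * (/ (1 - x)) ^ S p.
Proof.
intros Hx. set (y := / (1 - x)).
assert (Hy : 0 < y) by (apply Rinv_0_lt_compat; lra).
assert (Hxy : x * y + 1 = y) by (unfold y; field; lra).
revert p; induction m; intros p.
- assert (H : 0 <= x ^ p * y ^ S p) by (apply Rmult_le_pos; apply pow_le; lra).
  destruct p; cbn in *; nra.
- destruct p as [|p].
  + specialize (IHm O). rewrite bin_0_r in *. cbn [pow] in *.
    pose proof (pow_le x m ltac:(lra)). nra.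
  + cbn [bin]. pose proof (IHm p) as H1. pose proof (IHm (S p)) as H2.
    apply Rle_trans with (x * (x ^ p * y ^ S p + x ^ S p * y ^ S (S p))).
    * cbn [pow] in *. nra.
    * right. cbn [pow].
      transitivity (x * x ^ p * (y * y ^ p) * (x * y + 1)); [ring|].
      rewrite Hxy; ring.
Qed.

(** The length [M] is free, so that an even one can be chosen and the sum split by parity. *)
Lemma binomial_expansion (w : Cplx) (m M : nat) : (m < M)%nat ->
  ((1 + w) ^ m = Csum M (fun i => RtoC (bin m i) * w ^ i))%X.
Proof.
revert M; induction m; intros [|M] HM; try lia.
- rewrite Csum_first, Csum_0; [cbn; ring|]. intros; cbn; ring.
- rewrite Csum_first.
  rewrite (Csum_ext M _ (fun i => w * (RtoC (bin m i) * w ^ i)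
     + RtoC (bin m (S i)) * w ^ S i)%X)
    by (intros; cbn [bin]; rewrite RtoC_add; cbn [Cpow]; ring).
  rewrite Csum_add, Csum_scal.
  rewrite <- (IHm M) by lia.
  transitivity (w * (1 + w) ^ m + Csum (S M) (fun i => RtoC (bin m i) * w ^ i))%X.
  + rewrite <- (IHm (S M)) by lia. cbn [Cpow]; ring.
  + rewrite Csum_first, !bin_0_r. cbn [Cpow]. ring.
Qed.

(* [r_n(f; z) = sum_m fc m * moment n alpha m * z^m] *)
Definition moment (n : nat) (alpha : nat -> Cplx) (m : nat) : Cplx :=
  Csub (RtoC (INR m))
    (Csum n (fun k => Csub (Cpow (a_nk alpha k) m) (Cpow (b_nk alpha k) m))).

(** In the difference the even powers of [alpha_k/2] cancel and the odd ones double, which leaves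
    [-4^-i alpha_k^(2i+1)] times the binomial coefficient. The term with [S_1 = -1] cancels the [m]
    of [moment], and the following ones vanish up to [S_(2n-1)]. *)
Lemma moment_expansion (n : nat) (alpha : nat -> Cplx) (m J : nat) :
  (0 < n)%nat -> bessel_zeros n alpha -> (m < 2 * (n + J))%nat ->
  moment n alpha m = Csum J (fun j => RtoC (bin m (2 * (n + j) + 1) * (/ 4) ^ (n + j))
     * psum n alpha (2 * (n + j) + 1))%X.
Proof.
intros Hn Hz HJ. set (c i := RtoC (bin m (2 * i + 1) * (/ 4) ^ i)).
assert (Hk : forall k, (a_nk alpha k ^ m - b_nk alpha k ^ m =
    Csum (n + J) (fun i => 0 - c i * alpha k ^ (2 * i + 1)))%X).
{ intros k.
  replace (a_nk alpha k) with (1 + - (alpha k * RtoC (/ 2)))%X by (unfold a_nk; ring).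
  unfold b_nk. rewrite !(binomial_expansion _ m (2 * (n + J))) by easy.
  rewrite !Csum_even_odd.
  set (h := (alpha k * RtoC (/ 2))%X).
  assert (Hev : forall i, ((- h) ^ (2 * i) = h ^ (2 * i))%X).
  { intros i. rewrite <- !Cpow_sq. f_equal. ring. }
  rewrite (Csum_ext _ (fun i => RtoC (bin m (2 * i)) * (- h) ^ (2 * i))%X
     (fun i => RtoC (bin m (2 * i)) * h ^ (2 * i))%X) by (intros; now rewrite Hev).
  rewrite (Csum_ext _ (fun i => 0 - c i * alpha k ^ (2 * i + 1))%X
    (fun i => RtoC (bin m (2 * i + 1)) * (- h) ^ (2 * i + 1)
       - RtoC (bin m (2 * i + 1)) * h ^ (2 * i + 1))%X).
  - rewrite Csum_sub. ring.
  - intros i _. rewrite !Cpow_add, Hev. cbn [Cpow]. unfold h, c.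
    rewrite Cpow_mul. rewrite <- !RtoC_pow.
    rewrite (pow_mult (/ 2) 2 i). replace ((/ 2) ^ 2) with (/ 4) by field.
    rewrite !RtoC_mul.
    set (q := RtoC ((/ 4) ^ i)). set (b := RtoC (bin m (2 * i + 1))).
    assert (E : (RtoC (/ 2) + RtoC (/ 2) = 1)%X) by (rewrite <- RtoC_add; f_equal; field).
    transitivity (0 - (RtoC (/ 2) + RtoC (/ 2)) * b * q * (alpha k ^ (2 * i) * alpha k))%X;
      [rewrite E; ring|ring]. }
unfold moment. rewrite (Csum_ext n _ _ (fun k _ => Hk k)), Csum_exchange.
rewrite (Csum_ext (n + J) _ (fun i => 0 - c i * psum n alpha (2 * i + 1))%X).
2:{ intros i _. unfold psum.
  now rewrite Csum_sub, Csum_scal, (Csum_0 n (fun _ => 0%X)). }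
rewrite Csum_sub, (Csum_0 _ (fun _ => 0%X)) by easy.
rewrite Csum_split. destruct n as [|n]; [lia|].
rewrite Csum_first. change (2 * 0 + 1)%nat with 1%nat. rewrite psum_1 by easy.
rewrite Csum_0.
2:{ intros i Hi. rewrite psum_odd_0 by (easy || lia). ring. }
replace (c O) with (RtoC (INR m)); [unfold c; ring|].
unfold c. change (2 * 0 + 1)%nat with 1%nat. rewrite bin_1. cbn [pow]. f_equal; ring.
Qed.

Lemma moment_0 (n : nat) (alpha : nat -> Cplx) (m : nat) :
  (0 < n)%nat -> bessel_zeros n alpha -> (m <= 2 * n)%nat -> moment n alpha m = 0%X.
Proof.
intros Hn Hz Hm. rewrite (moment_expansion n alpha m (S m)) by (easy || lia).
apply Csum_0. intros j _. rewrite bin_small by lia. rewrite Rmult_0_l. ring.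
Qed.

Lemma factor_n_pos (n : nat) : 0 < factor_n n.
Proof. apply Rdiv_lt_0_compat; apply pow_lt, INR_fact_lt_0. Qed.

Lemma moment_le (n : nat) (alpha : nat -> Cplx) (x : R) (m : nat) :
  (13 <= n)%nat -> bessel_zeros n alpha -> 0 < x < 1 -> (x / (1 - x)) ^ 2 <= INR n + 1 ->
  Cnorm (moment n alpha m) * x ^ m <= 2 * (x ^ (2 * n + 1) * (/ (1 - x)) ^ (2 * n + 2) * factor_n n).
Proof.
intros Hn Hz Hx Ht. rewrite (moment_expansion n alpha m m) by (easy || lia).
set (K := x ^ (2 * n + 1) * (/ (1 - x)) ^ (2 * n + 2) * factor_n n).
set (r := 2 / (INR n + 1)). pose proof (pos_INR n) as Hn0.
assert (Hr : 0 < r) by (apply Rdiv_lt_0_compat; lra).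
pose proof (factor_n_pos n) as Hf.
assert (Hy : 0 < / (1 - x)) by (apply Rinv_0_lt_compat; lra).
assert (HK : 0 <= K).
{ unfold K. apply Rmult_le_pos; [apply Rmult_le_pos; apply pow_le|]; lra. }
apply Rle_trans with (Rsum m (fun j => K * (1 / 2) ^ j)).
- eapply Rle_trans; [apply Rmult_le_compat_r; [apply pow_le; lra|apply Cnorm_Csum_le]|].
  rewrite Rmult_comm, <- Rsum_scal. apply Rsum_le. intros j _.
  rewrite Cnorm_mul, Cnorm_RtoC_pos
    by (apply Rmult_le_pos; [apply bin_ge0|apply pow_le; lra]).
  set (p := (2 * (n + j) + 1)%nat).
  pose proof (psum_odd_tail_le n alpha j Hn Hz) as Ho. fold p r in Ho.
  rewrite Cnorm_psum_first_odd in Ho by (easy || lia).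
  pose proof (bin_pow_le x m p Hx) as Hb.
  set (y := / (1 - x)) in *.
  apply Rle_trans with ((x ^ p * y ^ S p) * (/ 4) ^ (n + j) * (r ^ j * (4 ^ n * factor_n n))).
  { transitivity ((bin m p * x ^ m) * (/ 4) ^ (n + j) * Cnorm (psum n alpha p)); [right; ring|].
    apply Rmult_le_compat; [|apply Cnorm_ge0| |easy].
    - apply Rmult_le_pos; [apply Rmult_le_pos; [apply bin_ge0|]|]; apply pow_le; lra.
    - apply Rmult_le_compat_r; [apply pow_le; lra|easy]. }
  (* Passing from [j] to [j + 1] costs [(x/(1-x))^2] from the binomial bound, the factor [1/4], and
     [r = 2/(n+1)] from the power sum: at most [1/2] in all. *)
  transitivity (K * (((x * y) ^ 2 * (r / 4)) ^ j)).
  + right. unfold K, p. replace (S (2 * (n + j) + 1))%nat with ((2 * n + 2) + 2 * j)%nat by lia.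
    replace (2 * (n + j) + 1)%nat with ((2 * n + 1) + 2 * j)%nat by lia.
    rewrite !(pow_add _ _ (2 * j)), (pow_add _ n j). unfold Rdiv.
    rewrite !(Rpow_mult_distr _ _ j), <- !pow_mult, (Rpow_mult_distr x y).
    rewrite (pow_inv 4 n). field. apply pow_nonzero; lra.
  + apply Rmult_le_compat_l; [easy|]. apply pow_incr. split.
    * apply Rmult_le_pos; [apply pow2_ge_0|lra].
    * fold y in Ht. unfold Rdiv in Ht. fold y in Ht.
      transitivity ((INR n + 1) * (r / 4)); [apply Rmult_le_compat_r; lra|].
      right; unfold r; field; lra.
- rewrite Rsum_scal, Rmult_comm. apply Rmult_le_compat_r; [easy|].
  eapply Rle_trans; [apply Rsum_geom_le; lra|]. lra.
Qed.

(** * The lower bound for [z/(1-z)] *)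

Lemma Rprod_le (N : nat) (u v : nat -> R) :
  (forall k, (k < N)%nat -> 0 <= u k <= v k) -> 0 <= Rprod N u <= Rprod N v.
Proof.
induction N; cbn; intros H; [lra|]. pose proof (H N ltac:(lia)).
destruct IHN; [auto with arith|]. split; [apply Rmult_le_pos; lra|].
apply Rmult_le_compat; lra.
Qed.
Lemma Rprod_const (N : nat) (c : R) : Rprod N (fun _ => c) = c ^ N.
Proof. induction N; cbn; [|rewrite IHN]; ring. Qed.
Lemma Rprod_exp (N : nat) (u : nat -> R) : Rprod N (fun k => exp (u k)) = exp (Rsum N u).
Proof. induction N; cbn; [symmetry; apply exp_0|now rewrite IHN, exp_plus]. Qed.

(* [|X - b|^2 <= X^2 exp (|b|^2/X^2 - 2 Re b/X)], and the exponents add up to a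
   nonpositive number because [sum b = 1/(2n-1)]. *)
Lemma prod_sub_sq_le (n : nat) (alpha : nat -> Cplx) (X : R) :
  (0 < n)%nat -> bessel_zeros n alpha -> 4 / (INR n + 1) <= X ->
  Rprod n (fun k => Cnorm (RtoC X - alpha k * alpha k)) <= X ^ n.
Proof.
intros Hn Hz HX. assert (H1 : 1 <= INR n) by (apply (le_INR 1); lia).
assert (HX0 : 0 < X) by (apply Rlt_le_trans with (2 := HX), Rdiv_lt_0_compat; lra).
set (b k := (alpha k * alpha k)%X).
set (e k := - (2 / X) * fst (b k) + / (X ^ 2) * (2 / (INR n + 1)) ^ 4).
assert (He : Rsum n e <= 0).
{ unfold e. rewrite Rsum_add, Rsum_scal, Rsum_const, <- (fst_Csum n b).
  replace (Csum n b) with (psum n alpha 2)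
    by (apply Csum_ext; intros; unfold b; cbn [Cpow]; ring).
  rewrite psum_2 by easy. cbn [RtoC fst].
  apply Rmult_le_reg_r with (X ^ 2); [apply pow_lt; lra|].
  transitivity (INR n * (2 / (INR n + 1)) ^ 4 - 2 / (2 * INR n - 1) * X);
    [right; field; lra|].
  assert (0 < 2 / (2 * INR n - 1)) by (apply Rdiv_lt_0_compat; lra).
  (* [X] is lowered to [4/(n+1)]; clearing denominators leaves [2n (2n-1) <= (n+1)^3]. *)
  transitivity (INR n * (2 / (INR n + 1)) ^ 4 - 2 / (2 * INR n - 1) * (4 / (INR n + 1)));
    [nra|].
  transitivity (8 * (2 * INR n * (2 * INR n - 1) - (INR n + 1) ^ 3) /
     ((2 * INR n - 1) * (INR n + 1) ^ 4)); [right; field; lra|].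
  rewrite Rmult_0_l.
  apply Rmult_le_reg_r with ((2 * INR n - 1) * (INR n + 1) ^ 4).
  - apply Rmult_lt_0_compat; [lra|apply pow_lt; lra].
  - unfold Rdiv. rewrite Rmult_assoc, Rinv_l, Rmult_0_l.
    + assert (2 * INR n * (2 * INR n - 1) <= (INR n + 1) ^ 3) by nra. lra.
    + apply Rmult_integral_contrapositive_currified; [lra|apply pow_nonzero; lra]. }
assert (Hsq : Rprod n (fun k => Cnorm (RtoC X - b k)) ^ 2 <= (X ^ n) ^ 2).
{ replace (Rprod n (fun k => Cnorm (RtoC X - b k)) ^ 2)
    with (Rprod n (fun k => Cnorm (RtoC X - b k) * Cnorm (RtoC X - b k)))
    by (rewrite Rprod_mul; ring).
  apply Rle_trans with (Rprod n (fun k => X ^ 2 * exp (e k))).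
  - apply Rprod_le. intros k Hk. split; [apply Rmult_le_pos; apply Cnorm_ge0|].
    apply Rle_trans with (X ^ 2 * (1 + e k)).
    + assert (Hb : Cnorm (b k) <= (2 / (INR n + 1)) ^ 2).
      { unfold b. rewrite Cnorm_mul. cbn [pow]. rewrite Rmult_1_r.
        apply Rmult_le_compat; try apply Cnorm_ge0; now apply bessel_zeros_bound. }
      assert (Hb2 : Cnorm (b k) ^ 2 <= (2 / (INR n + 1)) ^ 4).
      { replace 4%nat with (2 * 2)%nat by lia. rewrite pow_mult.
        apply pow_incr. split; [apply Cnorm_ge0|easy]. }
      rewrite Cnorm_sq in Hb2.
      replace (Cnorm (RtoC X - b k) * Cnorm (RtoC X - b k)) with
        (Cnorm (RtoC X - b k) ^ 2) by ring.
      rewrite Cnorm_sq. unfold e.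
      replace (X ^ 2 * (1 + (- (2 / X) * fst (b k) + / X ^ 2 * (2 / (INR n + 1)) ^ 4)))
        with (X ^ 2 - 2 * X * fst (b k) + (2 / (INR n + 1)) ^ 4) by (field; lra).
      destruct (b k) as [p q]. cbn [Csub Copp Cadd RtoC fst snd] in *. nra.
    + apply Rmult_le_compat_l; [apply pow2_ge_0|apply exp_ineq1_le].
  - rewrite Rprod_mul, Rprod_const, Rprod_exp, <- !pow_mult, (Nat.mul_comm 2 n).
    rewrite <- (Rmult_1_r (X ^ (n * 2))) at 2. apply Rmult_le_compat_l; [apply pow_le; lra|].
    rewrite <- exp_0. destruct He as [He|He]; [left; now apply exp_increasing|rewrite He; lra]. }
apply Rsqr_incr_0_var; [|apply pow_le; lra].
rewrite !Rsqr_pow2. exact Hsq.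
Qed.

Lemma g_fun_deriv (z : Cplx) : z <> 1%X ->
  has_cderiv g_fun z (1 / ((1 - z) * (1 - z)))%X.
Proof.
intros Hz eps Heps. set (d := (1 - z)%X).
assert (Hd : d <> 0%X) by (intros E; apply Csub_eq0 in E; congruence).
pose proof (Cnorm_gt0 d Hd) as Hd0. set (D := Cnorm d) in *.
(* The error of the difference quotient is exactly [h / (d^2 (d - h))]; [|h| < D/2] keeps
   [|d - h| > D/2], so its modulus is below [2 |h| / D^3]. *)
exists (Rmin (D / 2) (eps * D ^ 3 / 2)). split.
- apply Rmin_glb_lt; [lra|]. pose proof (pow_lt D 3 Hd0). nra.
- intros h [Hh0 Hh].
  assert (H1 : Cnorm h < D / 2) by (eapply Rlt_le_trans; [apply Hh|apply Rmin_l]).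
  assert (H2 : Cnorm h < eps * D ^ 3 / 2) by (eapply Rlt_le_trans; [apply Hh|apply Rmin_r]).
  pose proof (Cnorm_sub_ge d h) as H3. fold D in H3.
  assert (Hdh : (d - h)%X <> 0%X) by (apply Cnorm_neq0; lra).
  apply Cnorm_neq0 in Hh0.
  match goal with |- Cnorm ?e < _ => replace e with (h / (d * d * (d - h)))%X end.
  + rewrite Cnorm_div, !Cnorm_mul; fold D.
    2:{ intros E; apply Cmul_eq0 in E as [E|E]; [apply Cmul_eq0 in E as [E|E]|]; easy. }
    assert (0 < D * D * Cnorm (d - h)) by (repeat apply Rmult_lt_0_compat; lra).
    apply Rmult_lt_reg_r with (D * D * Cnorm (d - h)); [easy|].
    unfold Rdiv. rewrite Rmult_assoc, Rinv_l, Rmult_1_r by lra.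
    eapply Rlt_le_trans; [apply H2|].
    replace (eps * D ^ 3 / 2) with (eps * (D * D * (D / 2))) by field.
    apply Rmult_le_compat_l; [lra|]. apply Rmult_le_compat_l; [|lra].
    apply Rmult_le_pos; lra.
  + unfold g_fun, d in *. field. split; [exact Hd|split; [|exact Hh0]].
    intros E. change (1 - (z + h) = 0)%X in E. apply Hdh. rewrite <- E. ring.
Qed.

Lemma Cdiv_expand_fraction (r s p q : Cplx) :
  s <> 0%X -> p <> 0%X -> q = (s * p)%X -> (r / p = r * s / q)%X.
Proof. intros Hs Hp ->. field. auto. Qed.

(** With [a] and [b] for [a_nk] and [b_nk], [4 (1 - a z)(1 - b z) = z^2 (X - alpha_k^2)], so [g(a z)
    - g(b z) = -4 alpha_k / (z (X - alpha_k^2))]. The hypothesis on [X] keeps [a z] and [b z] away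
    from the pole of [g]. *)
Lemma g_fun_remainder (n : nat) (alpha : nat -> Cplx) (z : Cplx) :
  let X := ((1 + 1) * (1 - z) / z * ((1 + 1) * (1 - z) / z))%X in
  z <> 0%X -> z <> 1%X -> (forall k, (k < n)%nat -> X <> (alpha k * alpha k)%X) ->
  (r_n n alpha g_fun z (1 / ((1 - z) * (1 - z))) =
   z / ((1 - z) * (1 - z)) * (1 + X * Csum n (fun k => alpha k / (X - alpha k * alpha k))))%X.
Proof.
intros X Hz0 Hz1 HX. assert (Hd : (1 - z)%X <> 0%X)
  by (intros E; apply Csub_eq0 in E; congruence).
unfold r_n.
rewrite (Csum_ext n _ (fun k => - (z / ((1 - z) * (1 - z)) * X) *
    (alpha k / (X - alpha k * alpha k)))%X).
- rewrite Csum_scal. cfield.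
- intros k Hk. set (a := alpha k).
  assert (H2 := Cplx_two_neq0).
  assert (Hh : RtoC (/ 2) = (1 / (1 + 1))%X).
  { rewrite RtoC_inv, RtoC_2 by lra. cfield. }
  assert (HXa : (X - a * a)%X <> 0%X) by (intros E; apply Csub_eq0 in E; now apply (HX k)).
  assert (Hprod : ((1 + 1) * (1 + 1) * ((1 - a_nk alpha k * z) * (1 - b_nk alpha k * z))
     = z * z * (X - a * a))%X).
  { unfold a_nk, b_nk, X. fold a. rewrite Hh. cfield. }
  assert (Hne : (z * z * (X - a * a))%X <> 0%X).
  { intros E; apply Cmul_eq0 in E as [E|E]; [apply Cmul_eq0 in E as [E|E]|]; easy. }
  assert (Ha : (1 - a_nk alpha k * z)%X <> 0%X).
  { intros E; apply Hne; rewrite <- Hprod, E; ring. }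
  assert (Hb : (1 - b_nk alpha k * z)%X <> 0%X).
  { intros E; apply Hne; rewrite <- Hprod, E; ring. }
  transitivity ((a_nk alpha k - b_nk alpha k) * z /
     ((1 - a_nk alpha k * z) * (1 - b_nk alpha k * z)))%X.
  { unfold g_fun. cfield. }
  transitivity ((a_nk alpha k - b_nk alpha k) * z * ((1 + 1) * (1 + 1)) /
     (z * z * (X - a * a)))%X.
  { apply Cdiv_expand_fraction; [| |now symmetry];
      intros E; apply Cmul_eq0 in E as [E|E]; easy. }
  assert (Hab : ((a_nk alpha k - b_nk alpha k) = - a)%X).
  { unfold a_nk, b_nk. fold a. rewrite Hh. cfield. }
  rewrite Hab.
  assert (HzX : (z / ((1 - z) * (1 - z)) * X = (1 + 1) * (1 + 1) / z)%X).
  { unfold X. cfield. }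
  rewrite HzX. cfield.
Qed.

(** At [z = x] the hypothesis on [x] says [X >= 4/(n+1)], which exceeds every
    [|alpha_k|^2 <= 4/(n+1)^2]. The resolvent identity then divides [|S_(2n+1)|] by a product of
    modulus at most [X^n]. *)
Lemma g_fun_lower_bound (n : nat) (alpha : nat -> Cplx) (x : R) :
  (0 < n)%nat -> bessel_zeros n alpha -> 0 < x < 1 -> (x / (1 - x)) ^ 2 <= INR n + 1 ->
  x ^ (2 * n + 1) / (1 - x) ^ (2 * n + 2) * factor_n n <=
  Cnorm (r_n n alpha g_fun (RtoC x) (1 / ((1 - RtoC x) * (1 - RtoC x)))).
Proof.
intros Hn Hz Hx Ht. set (z := RtoC x).
assert (H1 : 1 <= INR n) by (apply (le_INR 1); lia).
assert (Hz0 : z <> 0%X) by (apply RtoC_neq0; lra).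
assert (Hz1 : z <> 1%X) by (intros E; apply RtoC_inj in E; lra).
set (T := 2 * (1 - x) / x). assert (HT : 0 < T) by (apply Rdiv_lt_0_compat; lra).
set (X := T * T).
assert (EX : ((1 + 1) * (1 - z) / z * ((1 + 1) * (1 - z) / z))%X = RtoC X).
{ unfold X, T, Rdiv. rewrite !RtoC_mul, RtoC_inv, RtoC_sub, RtoC_2 by lra. reflexivity. }
assert (HX : 4 / (INR n + 1) <= X).
{ apply Rmult_le_reg_r with ((INR n + 1) * (x / (1 - x)) ^ 2).
  - apply Rmult_lt_0_compat; [lra|]. apply pow_lt, Rdiv_lt_0_compat; lra.
  - transitivity (4 * (x / (1 - x)) ^ 2); [right; field; lra|].
    transitivity (4 * (INR n + 1)); [lra|]. right; unfold X, T; field; lra. }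
assert (HX0 : 0 < X) by (unfold X; nra).
assert (Hne : forall k, (k < n)%nat -> RtoC X <> (alpha k * alpha k)%X).
{ intros k Hk E. apply (f_equal Cnorm) in E.
  rewrite Cnorm_mul, Cnorm_RtoC_pos in E by lra.
  pose proof (bessel_zeros_bound n alpha k Hz Hk) as Hb. pose proof (Cnorm_ge0 (alpha k)).
  assert (Hlt : 2 / (INR n + 1) * (2 / (INR n + 1)) < 4 / (INR n + 1)).
  { apply Rmult_lt_reg_r with ((INR n + 1) ^ 2); [apply pow_lt; lra|].
    replace (2 / (INR n + 1) * (2 / (INR n + 1)) * (INR n + 1) ^ 2) with 4 by (field; lra).
    replace (4 / (INR n + 1) * (INR n + 1) ^ 2) with (4 * (INR n + 1)) by (field; lra). lra. }
  assert (Cnorm (alpha k) * Cnorm (alpha k) <= 2 / (INR n + 1) * (2 / (INR n + 1)))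
    by (apply Rmult_le_compat; easy). lra. }
rewrite g_fun_remainder; rewrite ?EX; try easy.
pose proof (psum_resolvent n alpha (RtoC X) Hn Hz Hne) as HR.
apply (f_equal Cnorm) in HR.
rewrite Cnorm_mul, Cnorm_Cprod, Cnorm_psum_first_odd in HR by easy.
pose proof (prod_sub_sq_le n alpha X Hn Hz HX) as HP.
set (P := Rprod n _) in *. rewrite Cnorm_mul. set (s := Cnorm (1 + _)) in *.
assert (Hs : 0 <= s) by apply Cnorm_ge0.
replace (z / ((1 - z) * (1 - z)))%X with (RtoC (x / ((1 - x) * (1 - x)))).
2:{ unfold Rdiv. rewrite RtoC_mul, RtoC_inv, RtoC_mul, RtoC_sub; [reflexivity|nra]. }
rewrite Cnorm_RtoC_pos by (apply Rdiv_le_0_compat; nra).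
assert (HXn : 0 < X ^ n) by now apply pow_lt.
assert (Hs2 : 4 ^ n * factor_n n / X ^ n <= s).
{ apply Rmult_le_reg_r with (X ^ n); [easy|]. unfold Rdiv.
  rewrite Rmult_assoc, Rinv_l, Rmult_1_r, <- HR by lra. nra. }
eapply Rle_trans; [|apply Rmult_le_compat_l; [apply Rdiv_le_0_compat; nra|exact Hs2]].
right. unfold X, T.
replace (2 * (1 - x) / x * (2 * (1 - x) / x)) with (4 * ((1 - x) ^ 2 * (/ x) ^ 2))
  by (field; lra).
rewrite !Rpow_mult_distr, <- !pow_mult, pow_inv, !pow_add, !pow_1.
field. repeat split; try apply pow_nonzero; lra.
Qed.

(** * Power series and the upper bound *)

(** [Cseries_cv] unfolds to [Clim] of the partial sums, so the limit rules below apply to series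
    directly. *)
Definition Clim (u : nat -> Cplx) (l : Cplx) : Prop :=
  Un_cv (fun N => Cnorm (Csub (u N) l)) 0.

Lemma Un_cv_0_le (u v : nat -> R) :
  (forall N, 0 <= u N <= v N) -> Un_cv v 0 -> Un_cv u 0.
Proof.
intros H Hv eps Heps. destruct (Hv eps Heps) as (N & HN). exists N. intros m Hm.
specialize (HN m Hm). specialize (H m). unfold Rdist in *.
rewrite Rminus_0_r in *. rewrite Rabs_pos_eq in * by lra. lra.
Qed.

Lemma Clim_add (u v : nat -> Cplx) (a b : Cplx) :
  Clim u a -> Clim v b -> Clim (fun N => u N + v N)%X (a + b)%X.
Proof.
intros Hu Hv. eapply Un_cv_0_le; [|rewrite <- (Rplus_0_r 0); apply (CV_plus _ _ _ _ Hu Hv)].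
intros N; split; [apply Cnorm_ge0|].
replace (u N + v N - (a + b))%X with ((u N - a) + (v N - b))%X by ring. apply Cnorm_triangle.
Qed.
Lemma Clim_const (c : Cplx) : Clim (fun _ => c) c.
Proof.
apply Un_cv_ext with (fun _ => 0); [|intros eps He; exists O; intros; now rewrite R_dist_eq].
intros; replace (c - c)%X with 0%X by ring. now rewrite Cnorm_0.
Qed.
Lemma Clim_scal (c : Cplx) (u : nat -> Cplx) (a : Cplx) :
  Clim u a -> Clim (fun N => c * u N)%X (c * a)%X.
Proof.
intros Hu. apply Un_cv_ext with (fun N => Cnorm c * Cnorm (u N - a)).
- intros N. rewrite <- Cnorm_mul. f_equal. ring.
- rewrite <- (Rmult_0_r (Cnorm c)). apply CV_mult; [|exact Hu].
  intros eps He; exists O; intros; now rewrite R_dist_eq.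
Qed.
Lemma Clim_ext (u v : nat -> Cplx) (a : Cplx) :
  (forall N, u N = v N) -> Clim u a -> Clim v a.
Proof. intros H. apply Un_cv_ext. intros; now rewrite H. Qed.
Lemma Clim_sub (u v : nat -> Cplx) (a b : Cplx) :
  Clim u a -> Clim v b -> Clim (fun N => u N - v N)%X (a - b)%X.
Proof.
intros Hu Hv. replace (a - b)%X with (a + - (1) * b)%X by ring.
apply Clim_ext with (fun N => u N + - (1) * v N)%X; [intros; ring|].
now apply Clim_add, Clim_scal.
Qed.
Lemma Clim_Csum (n : nat) (u : nat -> nat -> Cplx) (l : nat -> Cplx) :
  (forall k, (k < n)%nat -> Clim (u k) (l k)) ->
  Clim (fun N => Csum n (fun k => u k N)) (Csum n l).
Proof.
induction n; intros H; [exact (Clim_const 0%X)|]. cbn [Csum].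
apply Clim_add; [apply IHn|]; auto with arith.
Qed.
Lemma Clim_norm_le (u : nat -> Cplx) (l : Cplx) (B : R) :
  (forall N, Cnorm (u N) <= B) -> Clim u l -> Cnorm l <= B.
Proof.
intros HB Hl. apply Rnot_lt_le. intros Hlt.
destruct (Hl (Cnorm l - B)) as (N & HN); [lra|]. specialize (HN N (le_n N)).
unfold Rdist in HN. rewrite Rminus_0_r, Rabs_pos_eq in HN by apply Cnorm_ge0.
pose proof (Cnorm_sub_ge l (l - u N)) as H. replace (l - (l - u N))%X with (u N) in H by ring.
replace (u N - l)%X with (- (l - u N))%X in HN by ring. rewrite Cnorm_opp in HN.
specialize (HB N). lra.
Qed.

Lemma Rsum_sum_n (u : nat -> R) (N : nat) : Rsum (S N) u = sum_n u N.
Proof.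
induction N; [rewrite sum_O; cbn; ring|]. rewrite sum_Sn, <- IHN. reflexivity.
Qed.

Lemma Cseries_dominated (u : nat -> Cplx) (b : nat -> R) :
  (forall m, Cnorm (u m) <= b m) -> ex_series b -> exists l, Cseries_cv u l.
Proof.
intros Hb Hs.
destruct (@ex_series_le R_AbsRing R_CompleteNormedModule (fun m => fst (u m)) b) as (p & Hp);
  [intros; eapply Rle_trans; [apply fst_le_Cnorm|apply Hb]|easy|].
destruct (@ex_series_le R_AbsRing R_CompleteNormedModule (fun m => snd (u m)) b) as (q & Hq);
  [intros; eapply Rle_trans; [apply snd_le_Cnorm|apply Hb]|easy|].
exists (p, q).
apply is_lim_seq_Reals in Hp, Hq.
assert (Hp' : Un_cv (fun N => Rabs (sum_n (fun m => fst (u m)) N - p)) 0).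
{ intros eps He. destruct (Hp eps He) as (N & HN). exists N. intros m Hm.
  unfold Rdist. rewrite Rminus_0_r, Rabs_Rabsolu. now apply HN. }
assert (Hq' : Un_cv (fun N => Rabs (sum_n (fun m => snd (u m)) N - q)) 0).
{ intros eps He. destruct (Hq eps He) as (N & HN). exists N. intros m Hm.
  unfold Rdist. rewrite Rminus_0_r, Rabs_Rabsolu. now apply HN. }
eapply Un_cv_0_le; [|rewrite <- (Rplus_0_r 0); apply (CV_plus _ _ _ _ Hp' Hq')].
intros N; split; [apply Cnorm_ge0|]. eapply Rle_trans; [apply Cnorm_le_components|].
cbn [Csub Copp Cadd fst snd]. rewrite fst_Csum, snd_Csum, !Rsum_sum_n. right; reflexivity.
Qed.

(** An intermediate radius [sigma] trades the polynomial growth of [bin m p] in [m] for the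
    geometric factor [(rho/sigma)^m]. *)
Lemma bin_pow_geom_le (p m : nat) (rho sigma : R) : 0 < rho < sigma -> sigma < 1 ->
  bin m p * rho ^ m <= sigma ^ p * (/ (1 - sigma)) ^ S p * (rho / sigma) ^ m.
Proof.
intros Hr Hs. pose proof (bin_pow_le sigma m p ltac:(lra)) as H.
assert (Hq : 0 <= rho / sigma) by (apply Rdiv_le_0_compat; lra).
replace (rho ^ m) with (sigma ^ m * (rho / sigma) ^ m).
- rewrite <- Rmult_assoc. apply Rmult_le_compat_r; [now apply pow_le|easy].
- rewrite <- Rpow_mult_distr. f_equal. field; lra.
Qed.

(* The remainders [U m = (z+h)^m - z^m - m h z^(m-1)] satisfy
   [U (m+1) = (z+h) U m + m h^2 z^(m-1)]. *)
Lemma Cpow_taylor_le (z h : Cplx) (rho : R) (m : nat) :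
  0 < rho -> Cnorm z <= rho -> Cnorm (z + h) <= rho ->
  rho ^ 2 * Cnorm ((z + h) ^ m - z ^ m - h * (RtoC (INR m) * z ^ pred m))
    <= Cnorm h ^ 2 * (bin m 2 * rho ^ m).
Proof.
intros Hr Hz Hzh. induction m as [|m IH].
- replace ((z + h) ^ 0 - z ^ 0 - h * (RtoC (INR 0) * z ^ pred 0))%X with 0%X by (cbn; ring).
  rewrite Cnorm_0. cbn [bin]. lra.
- set (U := ((z + h) ^ m - z ^ m - h * (RtoC (INR m) * z ^ pred m))%X) in *.
  assert (E : ((z + h) ^ S m - z ^ S m - h * (RtoC (INR (S m)) * z ^ pred (S m)) =
     (z + h) * U + RtoC (INR m) * (h * h * z ^ pred m))%X).
  { unfold U. rewrite RtoC_INR_S. cbn [pred Cpow].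
    destruct m; [cbn; ring|]. cbn [pred Cpow]. ring. }
  rewrite E. clear E.
  change (bin (S m) 2) with (bin m 1 + bin m 2). rewrite bin_1.
  assert (HT : rho ^ 2 * Cnorm (RtoC (INR m) * (h * h * z ^ pred m)) <=
     Cnorm h ^ 2 * (INR m * rho ^ S m)).
  { destruct m as [|m].
    - cbn [INR]. match goal with |- _ * Cnorm ?e <= _ => replace e with 0%X by ring end.
      rewrite Cnorm_0; lra.
    - cbn [pred]. rewrite !Cnorm_mul, Cnorm_pow, Cnorm_RtoC_pos by apply pos_INR.
      assert (Cnorm z ^ m <= rho ^ m) by (apply pow_incr; split; [apply Cnorm_ge0|easy]).
      transitivity (rho ^ 2 * (INR (S m) * (Cnorm h * Cnorm h * rho ^ m))).
      + apply Rmult_le_compat_l; [apply pow2_ge_0|].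
        apply Rmult_le_compat_l; [apply pos_INR|].
        apply Rmult_le_compat_l; [|easy]. apply Rmult_le_pos; apply Cnorm_ge0.
      + right. cbn [pow]. ring. }
  assert (HU : rho ^ 2 * Cnorm ((z + h) * U) <= Cnorm h ^ 2 * (bin m 2 * rho ^ S m)).
  { rewrite Cnorm_mul.
    transitivity (rho * (rho ^ 2 * Cnorm U)).
    - pose proof (Cnorm_ge0 U). pose proof (pow2_ge_0 rho).
      transitivity (rho ^ 2 * (rho * Cnorm U)); [|right; ring].
      apply Rmult_le_compat_l; [easy|]. apply Rmult_le_compat_r; easy.
    - transitivity (rho * (Cnorm h ^ 2 * (bin m 2 * rho ^ m)));
        [apply Rmult_le_compat_l; lra|]. right; cbn [pow]; ring. }
  pose proof (Cnorm_triangle ((z + h) * U) (RtoC (INR m) * (h * h * z ^ pred m))) as Ht.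
  pose proof (pow2_ge_0 rho). nra.
Qed.

(** Termwise differentiation: the second-order remainders of the monomials have a total of at most
    [B |h|^2]. The derivative comes with its series, which later identifies the Taylor coefficients
    of the remainder. *)
Lemma power_series_deriv (fc : nat -> Cplx) (f : Cplx -> Cplx) (z : Cplx) :
  (forall m, Cnorm (fc m) <= 1) -> is_power_series fc f -> Cnorm z < 1 ->
  exists l, has_cderiv f z l /\
    Cseries_cv (fun m => fc m * (RtoC (INR m) * z ^ pred m))%X l.
Proof.
intros Hfc Hf Hz. pose proof (Cnorm_ge0 z) as Hz0.
(* [|z| < rho < sigma < 1] at equal distances: [z + h] stays within [rho], and [sigma] leaves room
   for the geometric comparison. *)
set (rho := (1 + 2 * Cnorm z) / 3). set (sigma := (2 + Cnorm z) / 3).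
assert (Hrs : 0 < rho < sigma /\ sigma < 1 /\ Cnorm z < rho) by (unfold rho, sigma; lra).
destruct Hrs as (Hr & Hs & Hzr).
set (q := rho / sigma).
assert (Hq : 0 <= q < 1).
{ unfold q. split; [apply Rdiv_le_0_compat; lra|].
  apply Rmult_lt_reg_r with sigma; [lra|]. unfold Rdiv; rewrite Rmult_assoc, Rinv_l; lra. }
set (K1 := sigma ^ 1 * (/ (1 - sigma)) ^ 2). set (K2 := sigma ^ 2 * (/ (1 - sigma)) ^ 3).
assert (Hi : 0 < / (1 - sigma)) by (apply Rinv_0_lt_compat; lra).
assert (HK2 : 0 <= K2) by (apply Rmult_le_pos; apply pow_le; lra).
destruct (Cseries_dominated (fun m => fc m * (RtoC (INR m) * z ^ pred m))%X
   (fun m => K1 / rho * q ^ m)) as (l & Hl).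
{ intros m. rewrite !Cnorm_mul, Cnorm_pow, Cnorm_RtoC_pos by apply pos_INR.
  assert (H1 : INR m * Cnorm z ^ pred m <= K1 / rho * q ^ m).
  { pose proof (bin_pow_geom_le 1 m rho sigma Hr Hs) as H. fold q K1 in H. rewrite bin_1 in H.
    apply Rmult_le_reg_r with rho; [lra|].
    transitivity (K1 * q ^ m); [|right; field; lra].
    eapply Rle_trans; [|exact H]. destruct m; [cbn [INR]; lra|]. cbn [pred pow].
    assert (Cnorm z ^ m <= rho ^ m) by (apply pow_incr; lra).
    transitivity (INR (S m) * rho ^ m * rho); [|right; ring].
    apply Rmult_le_compat_r; [lra|]. apply Rmult_le_compat_l; [apply pos_INR|easy]. }
  assert (0 <= INR m * Cnorm z ^ pred m)
    by (apply Rmult_le_pos; [apply pos_INR|now apply pow_le]).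
  specialize (Hfc m). pose proof (Cnorm_ge0 (fc m)). nra. }
{ apply @ex_series_scal_l. apply ex_series_geom. rewrite Rabs_pos_eq; lra. }
exists l. split; [|exact Hl].
set (B := K2 * / (1 - q) / rho ^ 2).
assert (Hrho2 : 0 < rho ^ 2) by (apply pow_lt; lra).
assert (HB : 0 <= B).
{ unfold B, Rdiv. apply Rmult_le_pos; [apply Rmult_le_pos|];
    try (left; apply Rinv_0_lt_compat); lra. }
intros eps Heps. exists (Rmin (rho - Cnorm z) (eps / (B + 1))). split.
{ apply Rmin_glb_lt; [lra|]. apply Rdiv_lt_0_compat; lra. }
intros h [Hh0 Hh].
assert (Hh1 : Cnorm h < rho - Cnorm z) by (eapply Rlt_le_trans; [apply Hh|apply Rmin_l]).
assert (Hh2 : Cnorm h < eps / (B + 1)) by (eapply Rlt_le_trans; [apply Hh|apply Rmin_r]).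
pose proof (Cnorm_triangle z h) as Hzh.
assert (Hn : Cnorm (f (z + h)%X - f z - h * l) <= Cnorm h ^ 2 * B).
{ apply Clim_norm_le with (fun N => Csum (S N) (fun m =>
    fc m * ((z + h) ^ m - z ^ m - h * (RtoC (INR m) * z ^ pred m)))%X).
  - intros N. eapply Rle_trans; [apply Cnorm_Csum_le|].
    apply Rle_trans with (Rsum (S N) (fun m => Cnorm h ^ 2 * (K2 / rho ^ 2) * q ^ m)).
    + apply Rsum_le. intros m _. rewrite Cnorm_mul.
      pose proof (Cpow_taylor_le z h rho m ltac:(lra) ltac:(lra) ltac:(lra)) as Ht.
      set (U := Cnorm (_ - _)) in *.
      assert (HU : 0 <= U) by apply Cnorm_ge0.
      pose proof (bin_pow_geom_le 2 m rho sigma Hr Hs) as Hb. fold q K2 in Hb.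
      apply Rle_trans with U; [specialize (Hfc m); nra|].
      apply Rmult_le_reg_l with (rho ^ 2); [easy|].
      eapply Rle_trans; [exact Ht|].
      transitivity (Cnorm h ^ 2 * (K2 * q ^ m)).
      * apply Rmult_le_compat_l; [apply pow2_ge_0|easy].
      * right; field; lra.
    + rewrite Rsum_scal. unfold B.
      transitivity (Cnorm h ^ 2 * (K2 / rho ^ 2) * / (1 - q)); [|right; field; lra].
      apply Rmult_le_compat_l; [|now apply Rsum_geom_le].
      apply Rmult_le_pos; [apply pow2_ge_0|]. apply Rdiv_le_0_compat; lra.
  - apply Clim_ext with (fun N => Csum (S N) (fun m => fc m * (z + h) ^ m) -
       Csum (S N) (fun m => fc m * z ^ m) -
       h * Csum (S N) (fun m => fc m * (RtoC (INR m) * z ^ pred m)))%X.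
    + intros N. rewrite <- Csum_scal, <- !Csum_sub. apply Csum_ext; intros; ring.
    + apply Clim_sub; [apply Clim_sub; apply Hf; lra|]. now apply Clim_scal. }
apply Cnorm_neq0 in Hh0 as Hh0'.
replace ((f (z + h)%X - f z) / h - l)%X with ((f (z + h)%X - f z - h * l) / h)%X
  by (field; easy).
rewrite Cnorm_div by easy.
apply Rmult_lt_reg_r with (Cnorm h); [easy|].
unfold Rdiv. rewrite Rmult_assoc, Rinv_l, Rmult_1_r by lra.
eapply Rle_lt_trans; [exact Hn|].
assert (Cnorm h * (B + 1) < eps).
{ apply Rmult_lt_reg_r with (/ (B + 1)); [apply Rinv_0_lt_compat; lra|].
  rewrite Rmult_assoc, Rinv_r, Rmult_1_r by lra. exact Hh2. }
nra.
Qed.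

Lemma Rsum_geom_tail_le (N p : nat) (q : R) : 0 <= q < 1 ->
  Rsum N (fun m => if Nat.ltb m p then 0 else q ^ m) <= q ^ p / (1 - q).
Proof.
intros Hq.
assert (H : Rsum N (fun m => if Nat.ltb m p then 0 else q ^ m) * (1 - q) <=
   q ^ p - (if Nat.ltb N p then q ^ p else q ^ N)).
{ induction N.
  - cbn [Rsum]. destruct (Nat.ltb_spec 0 p); [lra|]. replace p with O by lia. lra.
  - cbn [Rsum]. rewrite Rmult_plus_distr_r.
    destruct (Nat.ltb_spec N p), (Nat.ltb_spec (S N) p); try lia; try lra.
    + replace p with (S N) in * by lia. lra.
    + cbn [pow]. lra. }
assert (0 <= q ^ p /\ 0 <= q ^ N) by (split; now apply pow_le).
apply Rmult_le_reg_r with (1 - q); [lra|]. unfold Rdiv. rewrite Rmult_assoc, Rinv_l by lra.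
destruct (Nat.ltb N p); lra.
Qed.

Lemma remainder_bound (x : R) (fc : nat -> Cplx) (f : Cplx -> Cplx) (n : nat)
    (alpha : nat -> Cplx) (z : Cplx) :
  0 < x < 1 -> (forall m, Cnorm (fc m) <= 1) -> is_power_series fc f ->
  (13 <= n)%nat -> (x / (1 - x)) ^ 2 <= INR n + 1 -> bessel_zeros n alpha -> Cnorm z < x ->
  exists l, has_cderiv f z l /\
    Cnorm (r_n n alpha f z l) <=
      Cnorm z ^ (2 * n + 1) / (x - Cnorm z) * (2 * x / (1 - x) ^ (2 * n + 2)) * factor_n n.
Proof.
intros Hx Hfc Hf Hn Ht Hz Hzx. pose proof (Cnorm_ge0 z) as Hz0. pose proof (pos_INR n) as Hn0.
destruct (power_series_deriv fc f z Hfc Hf ltac:(lra)) as (l & Hd & Hl).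
exists l. split; [exact Hd|].
(* Since [|a_nk|] and [|b_nk|] are at most [1 + 1/(n+1)], this keeps [a_nk z] and [b_nk z] in the
   unit disc, where [f] is given by its series. *)
assert (Hx2 : x * (1 + 1 / (INR n + 1)) <= 1).
{ assert (H1 : x / (1 - x) <= INR n + 1).
  { assert (0 < x / (1 - x)) by (apply Rdiv_lt_0_compat; lra). nra. }
  assert (H2 : x <= (INR n + 1) * (1 - x)).
  { replace x with (x / (1 - x) * (1 - x)) at 1 by (field; lra).
    apply Rmult_le_compat_r; lra. }
  apply Rmult_le_reg_r with (INR n + 1); [lra|].
  transitivity (x * (INR n + 2)); [right; field; lra|lra]. }
assert (Hz1 : forall w, Cnorm w <= 1 + 1 / (INR n + 1) -> Cnorm (w * z) < 1).
{ intros w Hw. rewrite Cnorm_mul.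
  assert (0 < 1 / (INR n + 1)) by (apply Rdiv_lt_0_compat; lra).
  apply Rle_lt_trans with ((1 + 1 / (INR n + 1)) * Cnorm z).
  - apply Rmult_le_compat_r; easy.
  - nra. }
assert (Hal : forall k, (k < n)%nat -> Cnorm (alpha k * RtoC (/ 2)) <= 1 / (INR n + 1)).
{ intros k Hk. rewrite Cnorm_mul, Cnorm_RtoC_pos by lra.
  pose proof (bessel_zeros_bound n alpha k Hz Hk).
  replace (1 / (INR n + 1)) with (2 / (INR n + 1) * / 2) by (field; lra). lra. }
assert (N1 : Cnorm 1 = 1) by (apply Cnorm_RtoC_pos; lra).
set (q := Cnorm z / x).
assert (Hq : 0 <= q < 1).
{ unfold q. split; [apply Rdiv_le_0_compat; lra|].
  apply Rmult_lt_reg_r with x; [lra|]. unfold Rdiv; rewrite Rmult_assoc, Rinv_l; lra. }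
set (K := 2 * (x ^ (2 * n + 1) * (/ (1 - x)) ^ (2 * n + 2) * factor_n n)).
assert (HK : 0 <= K).
{ pose proof (factor_n_pos n). assert (0 < / (1 - x)) by (apply Rinv_0_lt_compat; lra).
  unfold K. apply Rmult_le_pos; [lra|]. apply Rmult_le_pos; [|lra].
  apply Rmult_le_pos; apply pow_le; lra. }
apply Clim_norm_le with (fun N => Csum (S N) (fun m => fc m * (moment n alpha m * z ^ m))%X).
- intros N. eapply Rle_trans; [apply Cnorm_Csum_le|].
  apply Rle_trans with (Rsum (S N) (fun m => K * if Nat.ltb m (2 * n + 1) then 0 else q ^ m)).
  + apply Rsum_le. intros m _. rewrite !Cnorm_mul, Cnorm_pow.
    destruct (Nat.ltb_spec m (2 * n + 1)) as [Hm|Hm].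
    * rewrite moment_0 by (easy || lia). rewrite Cnorm_0. lra.
    * pose proof (moment_le n alpha x m Hn Hz Hx Ht) as HM. fold K in HM.
      assert (E : Cnorm z ^ m = x ^ m * q ^ m).
      { rewrite <- Rpow_mult_distr. f_equal. unfold q; field; lra. }
      rewrite E. pose proof (Hfc m). pose proof (Cnorm_ge0 (fc m)).
      pose proof (pow_le q m (proj1 Hq)).
      assert (0 <= Cnorm (moment n alpha m) * x ^ m)
        by (apply Rmult_le_pos; [apply Cnorm_ge0|apply pow_le; lra]).
      transitivity (Cnorm (fc m) * ((Cnorm (moment n alpha m) * x ^ m) * q ^ m));
        [right; ring|].
      assert (Cnorm (moment n alpha m) * x ^ m * q ^ m <= K * q ^ m)
        by (apply Rmult_le_compat_r; easy).
      assert (0 <= Cnorm (moment n alpha m) * x ^ m * q ^ m) by (apply Rmult_le_pos; easy).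
      nra.
  + rewrite Rsum_scal.
    transitivity (K * (q ^ (2 * n + 1) / (1 - q))).
    * apply Rmult_le_compat_l; [easy|]. now apply Rsum_geom_tail_le.
    * right. unfold K, q, Rdiv. rewrite Rpow_mult_distr, !pow_inv.
      assert (x ^ (2 * n + 1) <> 0) by (apply pow_nonzero; lra).
      assert ((1 - x) ^ (2 * n + 2) <> 0) by (apply pow_nonzero; lra).
      field. repeat split; lra.
- unfold r_n.
  apply Clim_ext with (fun N => z * Csum (S N) (fun m => fc m * (RtoC (INR m) * z ^ pred m)) -
    Csum n (fun k => Csum (S N) (fun m => fc m * (a_nk alpha k * z) ^ m)
       - Csum (S N) (fun m => fc m * (b_nk alpha k * z) ^ m)))%X.
  + intros N. rewrite <- Csum_scal.
    rewrite (Csum_ext n _ (fun k => Csum (S N) (fun m =>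
       fc m * (a_nk alpha k * z) ^ m - fc m * (b_nk alpha k * z) ^ m))%X)
      by (intros; now rewrite Csum_sub).
    rewrite Csum_exchange, <- Csum_sub. apply Csum_ext. intros m _.
    rewrite (Csum_ext n _ (fun k => (fc m * z ^ m) * (a_nk alpha k ^ m - b_nk alpha k ^ m))%X)
      by (intros; rewrite !Cpow_mul; ring).
    rewrite Csum_scal. unfold moment.
    destruct m; [cbn; ring|]. cbn [pred Cpow]. ring.
  + apply Clim_sub; [now apply Clim_scal|]. apply Clim_Csum. intros k Hk.
    pose proof (Hal k Hk). apply Clim_sub; apply Hf, Hz1.
    * unfold a_nk. pose proof (Cnorm_sub_le 1 (alpha k * RtoC (/ 2))). lra.
    * unfold b_nk. pose proof (Cnorm_triangle 1 (alpha k * RtoC (/ 2))). lra.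
Qed.

Lemma g_fun_power_series :
  is_power_series (fun m => match m with O => RtoC 0 | _ => RtoC 1 end) g_fun.
Proof.
intros w Hw.
assert (Hd : (1 - w)%X <> 0%X).
{ intros E. apply Csub_eq0 in E. rewrite <- E, Cnorm_RtoC_pos in Hw; lra. }
assert (HS : forall N, Csum (S N) (fun m => match m with O => 0 | _ => 1 end * w ^ m)%X
   = (g_fun w - w ^ S N / (1 - w))%X).
{ induction N.
  - unfold g_fun. cbn. field. easy.
  - change (Csum (S (S N)) (fun m => match m with O => 0 | _ => 1 end * w ^ m)%X)
      with (Csum (S N) (fun m => match m with O => 0 | _ => 1 end * w ^ m) + 1 * w ^ S N)%X.
    rewrite IHN. cbn [Cpow]. field. easy. }
apply Un_cv_ext with (fun N => Cnorm w / Cnorm (1 - w) * Cnorm w ^ N).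
- intros N. rewrite HS.
  replace (g_fun w - w ^ S N / (1 - w) - g_fun w)%X with (- (w ^ S N / (1 - w)))%X by ring.
  rewrite Cnorm_opp, Cnorm_div, Cnorm_pow by easy. cbn [pow]. unfold Rdiv. ring.
- rewrite <- (Rmult_0_r (Cnorm w / Cnorm (1 - w))). apply CV_mult.
  + intros eps He; exists O; intros; now rewrite R_dist_eq.
  + apply is_lim_seq_Reals, is_lim_seq_geom. rewrite Rabs_pos_eq; [easy|apply Cnorm_ge0].
Qed.

(** * The choice [x = sqrt n / (1 + sqrt n)] *)

Lemma factor_n_S (n : nat) : factor_n (S n) = factor_n n / (4 * (2 * INR n + 1) ^ 2).
Proof.
unfold factor_n. replace (2 * S n)%nat with (S (S (2 * n))) by lia.
rewrite !fact_simpl, !mult_INR, !S_INR, mult_INR. cbn [INR].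
pose proof (pos_INR n). pose proof (INR_fact_neq_0 (2 * n)). field. repeat split; lra.
Qed.

Lemma exp_le_inv (u : R) : u < 1 -> exp u <= / (1 - u).
Proof.
intros Hu. rewrite <- (Ropp_involutive u) at 1. rewrite exp_Ropp.
apply Rinv_le_contravar; [lra|]. pose proof (exp_ineq1_le (- u)). lra.
Qed.

Lemma exp_mult_nat (u : R) (k : nat) : exp (INR k * u) = exp u ^ k.
Proof.
induction k; [cbn [INR pow]; rewrite Rmult_0_l; apply exp_0|].
rewrite S_INR, Rmult_plus_distr_r, exp_plus, IHk, Rmult_1_l. cbn [pow]. ring.
Qed.

Lemma sqrt_13_bounds : 3605 / 1000 <= sqrt 13 <= 3606 / 1000.
Proof.
pose proof (sqrt_sqrt 13 ltac:(lra)). pose proof (sqrt_pos 13). split; nra.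
Qed.

(* Up to the factor [2 (1 + 1/sqrt n)], an upper bound for [n^(n-1)] times the constant of
   the main estimate at [x = sqrt n / (1 + sqrt n)], since [(1 + 1/s)^(2n) <= exp (2s)]
   for [s = sqrt n]. *)
Definition growth (n : nat) : R := INR n ^ (2 * n) * factor_n n * exp (2 * sqrt (INR n)).

(** The exponent is twice 3.606, an upper bound for [2 sqrt 13]. It is cut into small pieces because
    [exp u <= 1/(1-u)] is accurate only for small [u]. *)
Lemma exp_7212_thousandths_le : exp (7212 / 1000) <= 1560.
Proof.
assert (E : 7212 / 1000 = INR 7 * (INR 32 * (1 / 32)) + 212 / 1000) by (cbn [INR]; field).
rewrite E, exp_plus, !exp_mult_nat.
pose proof (exp_le_inv (1 / 32) ltac:(lra)) as H1.
pose proof (exp_le_inv (212 / 1000) ltac:(lra)) as H2.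
pose proof (exp_pos (1 / 32)). pose proof (exp_pos (212 / 1000)).
apply Rle_trans with (((32 / 31) ^ 32) ^ 7 * (1000 / 788)).
- apply Rmult_le_compat; [apply pow_le, pow_le; lra|lra| |lra].
  apply pow_incr; split; [apply pow_le; lra|]. apply pow_incr; lra.
- lra.
Qed.

(** [2116/2500] is [0.92^2], and 2.555 lies just above [2 (1 + 1/3.605)], a bound for the factor
    [2 (1 + 1/sqrt n)] that [growth] leaves out. *)
Lemma growth_13 : growth 13 <= (2116 / 2500) ^ 13 / (2555 / 1000).
Proof.
unfold growth. rewrite !factor_n_S.
replace (factor_n 0) with 1 by (unfold factor_n; cbn; field).
pose proof exp_7212_thousandths_le as He. pose proof sqrt_13_bounds as Hs.
assert (E : INR 13 = 13) by (cbn [INR]; ring). rewrite E.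
assert (exp (2 * sqrt 13) <= 1560).
{ eapply Rle_trans; [|exact He].
  destruct (Rle_lt_or_eq_dec (2 * sqrt 13) (7212 / 1000)) as [L| ->]; [lra| |lra].
  left; now apply exp_increasing. }
cbn [INR]. set (e := exp (2 * sqrt 13)) in *. assert (0 < e) by apply exp_pos.
change (2 * 13)%nat with 26%nat.
lra.
Qed.

(** The ratio is at most [9 (3605/2605)] times [(N+1)^2 / (4 (2N+1)^2)]: 9 bounds [(1 + 1/N)^(2N)],
    and [3605/2605] bounds the growth of [exp (2 sqrt N)], whose exponent rises by at most
    [1/sqrt 13]. The last fraction is largest at [N = 13], where it is [49/729]; the product is
    about 0.837, below 0.8464. *)
Lemma growth_S (n : nat) : (13 <= n)%nat -> growth (S n) <= 2116 / 2500 * growth n.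
Proof.
intros Hn. assert (Hn' : 13 <= INR n) by (replace 13 with (INR 13) by (cbn; ring); now apply le_INR).
unfold growth. rewrite factor_n_S, S_INR.
set (N := INR n) in *.
pose proof (factor_n_pos n) as HF. set (F := factor_n n) in *.
assert (HNn : 0 < N ^ (2 * n)) by (apply pow_lt; lra).
assert (H1 : (N + 1) ^ (2 * S n) <= N ^ (2 * n) * 9 * (N + 1) ^ 2).
{ replace (2 * S n)%nat with (2 * n + 2)%nat by lia. rewrite pow_add.
  apply Rmult_le_compat_r; [apply pow2_ge_0|].
  replace (N + 1) with (N * (1 + / N)) by (field; lra). rewrite Rpow_mult_distr.
  apply Rmult_le_compat_l; [lra|]. rewrite Nat.mul_comm, pow_mult.
  assert (H : (1 + / N) ^ n <= 3).
  { eapply Rle_trans; [|exact exp_le_3].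
    replace 1 with (INR n * / N) at 2 by (unfold N; field; fold N; lra).
    rewrite exp_mult_nat. apply pow_incr. split.
    - assert (0 < / N) by (apply Rinv_0_lt_compat; lra). lra.
    - apply exp_ineq1_le. }
  assert (0 <= (1 + / N) ^ n).
  { apply pow_le. assert (0 < / N) by (apply Rinv_0_lt_compat; lra). lra. }
  nra. }
assert (H2 : exp (2 * sqrt (N + 1)) <= exp (2 * sqrt N) * (3605 / 2605)).
{ pose proof (sqrt_sqrt N ltac:(lra)) as S1. pose proof (sqrt_sqrt (N + 1) ltac:(lra)) as S2.
  assert (S3 : 3605 / 1000 <= sqrt N).
  { eapply Rle_trans; [apply sqrt_13_bounds|]. now apply sqrt_le_1_alt. }
  assert (S4 : sqrt N <= sqrt (N + 1)) by (apply sqrt_le_1_alt; lra).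
  assert (S5 : 2 * sqrt (N + 1) <= 2 * sqrt N + 1000 / 3605) by nra.
  apply Rle_trans with (exp (2 * sqrt N + 1000 / 3605)).
  - destruct S5 as [S5|S5]; [left; now apply exp_increasing|rewrite S5; lra].
  - rewrite exp_plus. apply Rmult_le_compat_l; [left; apply exp_pos|].
    eapply Rle_trans; [apply exp_le_inv; lra|]. lra. }
set (e := exp (2 * sqrt N)) in *. set (P := N ^ (2 * n)) in *.
assert (He : 0 < e) by apply exp_pos.
assert (Hd : 0 < 4 * (2 * N + 1) ^ 2) by nra.
apply Rle_trans with ((P * 9 * (N + 1) ^ 2) * (F / (4 * (2 * N + 1) ^ 2)) * (e * (3605 / 2605))).
- apply Rmult_le_compat; [|left; apply exp_pos| |easy].
  + apply Rmult_le_pos; [apply pow_le; lra|]. apply Rdiv_le_0_compat; lra.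
  + apply Rmult_le_compat_r; [apply Rdiv_le_0_compat; lra|easy].
- transitivity ((P * F * e) * (9 * (3605 / 2605) * ((N + 1) ^ 2 / (4 * (2 * N + 1) ^ 2))));
    [right; field; lra|].
  rewrite (Rmult_comm (2116 / 2500)). apply Rmult_le_compat_l.
  + apply Rmult_le_pos; [|lra]. apply Rmult_le_pos; lra.
  + assert ((N + 1) ^ 2 / (4 * (2 * N + 1) ^ 2) <= 49 / 729).
    { apply Rmult_le_reg_r with (4 * (2 * N + 1) ^ 2); [easy|].
      unfold Rdiv at 1. rewrite Rmult_assoc, Rinv_l, Rmult_1_r by lra. nra. }
    lra.
Qed.

Lemma growth_le (n : nat) : (13 <= n)%nat -> growth n <= (2116 / 2500) ^ n / (2555 / 1000).
Proof.
intros Hn. induction Hn as [|n Hn IH]; [apply growth_13|].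
eapply Rle_trans; [apply growth_S; easy|]. cbn [pow]. lra.
Qed.

(** Here [1 - x = 1/(1+s)], so the left side is [2 s (1+s) (1+s)^(2n)] times [factor_n n]. By
    [(1+s)^(2n) <= n^n exp (2s)], its product with [n^(n-1)] is at most [2 (1 + 1/s)] times
    [growth n]. *)
Lemma special_constant (n : nat) : (13 <= n)%nat ->
  let x := sqrt (INR n) / (1 + sqrt (INR n)) in
  2 * x / (1 - x) ^ (2 * n + 2) * factor_n n <= (92 / 100) ^ (2 * n) / INR n ^ (n - 1).
Proof.
intros Hn x. assert (Hn' : 13 <= INR n) by (replace 13 with (INR 13) by (cbn; ring); now apply le_INR).
pose proof (growth_le n Hn) as HG. unfold growth in HG.
set (s := sqrt (INR n)) in *. pose proof (factor_n_pos n) as HF.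
assert (Hss : s * s = INR n) by (apply sqrt_sqrt; lra).
assert (Hs : 3605 / 1000 <= s).
{ eapply Rle_trans; [apply sqrt_13_bounds|]. now apply sqrt_le_1_alt. }
replace (1 - x) with (/ (1 + s)) by (unfold x; field; lra).
assert (Hp : (1 + s) ^ (2 * n) <= INR n ^ n * exp (2 * s)).
{ replace (1 + s) with (s * (1 + / s)) by (field; lra). rewrite Rpow_mult_distr.
  rewrite (pow_mult s). replace (s ^ 2) with (INR n) by (rewrite <- Hss; ring).
  apply Rmult_le_compat_l; [apply pow_le; lra|].
  replace (2 * s) with (INR (2 * n) * / s).
  - rewrite exp_mult_nat. apply pow_incr.
    assert (0 < / s) by (apply Rinv_0_lt_compat; lra). split; [lra|apply exp_ineq1_le].
  - rewrite mult_INR, <- Hss. cbn [INR]. field; lra. }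
assert (Hn1 : 0 < INR n ^ (n - 1)) by (apply pow_lt; lra).
apply Rmult_le_reg_r with (INR n ^ (n - 1)); [easy|].
replace ((92 / 100) ^ (2 * n) / INR n ^ (n - 1) * INR n ^ (n - 1))
  with ((92 / 100) ^ (2 * n)) by (field; lra).
transitivity (2 * s * (1 + s) * ((1 + s) ^ (2 * n) * (factor_n n * INR n ^ (n - 1)))).
{ right. unfold x. rewrite pow_inv, pow_add. field. repeat split; try apply pow_nonzero; lra. }
transitivity (2 * s * (1 + s) * ((INR n ^ n * exp (2 * s)) * (factor_n n * INR n ^ (n - 1)))).
{ apply Rmult_le_compat_l; [nra|]. apply Rmult_le_compat_r; [|easy].
  apply Rmult_le_pos; lra. }
transitivity (2 * (1 + / s) * (INR n ^ (2 * n) * factor_n n * exp (2 * s))).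
{ right. replace (2 * n)%nat with (n + S (n - 1))%nat by lia. rewrite pow_add. cbn [pow].
  rewrite <- Hss. field. lra. }
assert (Hi : / s <= 1000 / 3605).
{ replace (1000 / 3605) with (/ (3605 / 1000)) by field. apply Rinv_le_contravar; lra. }
assert (0 < / s) by (apply Rinv_0_lt_compat; lra).
rewrite (pow_mult (92 / 100) 2 n). replace ((92 / 100) ^ 2) with (2116 / 2500) by field.
pose proof (pow_lt (2116 / 2500) n ltac:(lra)).
transitivity (2 * (1 + / s) * ((2116 / 2500) ^ n / (2555 / 1000))).
- apply Rmult_le_compat_l; [lra|exact HG].
- transitivity (2 * (1 + 1000 / 3605) * ((2116 / 2500) ^ n / (2555 / 1000))); [|lra].
  apply Rmult_le_compat_r; [apply Rdiv_le_0_compat; lra|lra].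
Qed.

Lemma n0_consequences (x : R) (n : nat) : 0 < x < 1 -> INR n >= n0 x ->
  (13 <= n)%nat /\ (x / (1 - x)) ^ 2 <= INR n + 1.
Proof.
intros Hx Hn. unfold n0 in Hn.
pose proof (Rmax_l 14 (x ^ 2 / (1 - x) ^ 2)). pose proof (Rmax_r 14 (x ^ 2 / (1 - x) ^ 2)).
split.
- apply INR_le. replace (INR 13) with 13 by (cbn; ring). lra.
- replace ((x / (1 - x)) ^ 2) with (x ^ 2 / (1 - x) ^ 2) by (field; lra). lra.
Qed.

Theorem theorem1 :
  (* main bound *)
  (forall (x : R) (fc : nat -> Cplx) (f : Cplx -> Cplx) (n : nat) (alpha : nat -> Cplx),
     0 < x < 1 ->
     (forall m, Cnorm (fc m) <= 1) ->
     is_power_series fc f ->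
     INR n >= n0 x ->
     bessel_zeros n alpha ->
     forall z : Cplx, Cnorm z < x ->
       exists l, has_cderiv f z l /\
         Cnorm (r_n n alpha f z l) <=
           Cnorm z ^ (2 * n + 1) / (x - Cnorm z)
           * (2 * x / (1 - x) ^ (2 * n + 2)) * factor_n n)
  /\
  (* sharpness for g(z) = z/(1-z) = sum_{m>=1} z^m *)
  (is_power_series (fun m => match m with O => RtoC 0 | _ => RtoC 1 end) g_fun /\
   forall (x : R) (n : nat) (alpha : nat -> Cplx),
     0 < x < 1 ->
     INR n >= n0 x ->
     bessel_zeros n alpha ->
     exists z : Cplx, Cnorm z = x /\
       exists l, has_cderiv g_fun z l /\
         Cnorm (r_n n alpha g_fun z l) >=
           x ^ (2 * n + 1) / (1 - x) ^ (2 * n + 2) * factor_n n)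
  /\
  (* the special choice x_n = sqrt n / (1 + sqrt n) *)
  (forall (fc : nat -> Cplx) (f : Cplx -> Cplx) (n : nat) (alpha : nat -> Cplx),
     (n >= 13)%nat ->
     (forall m, Cnorm (fc m) <= 1) ->
     is_power_series fc f ->
     bessel_zeros n alpha ->
     forall z : Cplx, Cnorm z < sqrt (INR n) / (1 + sqrt (INR n)) ->
       exists l, has_cderiv f z l /\
         Cnorm (r_n n alpha f z l) <=
           Cnorm z ^ (2 * n + 1) / (sqrt (INR n) / (1 + sqrt (INR n)) - Cnorm z)
           * ((92 / 100) ^ (2 * n) / INR n ^ (n - 1))).
Proof.
split; [|split; [split; [exact g_fun_power_series|]|]].
- intros x fc f n alpha Hx Hfc Hf Hn Hz z Hzx.
  destruct (n0_consequences x n Hx Hn) as [Hn13 Ht]. exact (remainder_bound x fc f n alpha z Hx Hfc Hf Hn13 Ht Hz Hzx).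
- intros x n alpha Hx Hn Hz. destruct (n0_consequences x n Hx Hn) as [Hn13 Ht].
  (* The maximum over the circle is bounded below by the value at its positive real point. *)
  exists (RtoC x). split; [apply Cnorm_RtoC_pos; lra|].
  exists (1 / ((1 - RtoC x) * (1 - RtoC x)))%X. split.
  + apply g_fun_deriv. intros E; apply RtoC_inj in E; lra.
  + apply Rle_ge, g_fun_lower_bound; (easy || lia).
- intros fc f n alpha Hn Hfc Hf Hz z Hzx.
  assert (Hs : 0 < sqrt (INR n)) by (apply sqrt_lt_R0, lt_0_INR; lia).
  set (x := sqrt (INR n) / (1 + sqrt (INR n))) in *.
  assert (H1x : 1 - x = / (1 + sqrt (INR n))) by (unfold x; field; lra).
  assert (Hx : 0 < x < 1).
  { split; [apply Rdiv_lt_0_compat; lra|].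
    assert (0 < / (1 + sqrt (INR n))) by (apply Rinv_0_lt_compat; lra). lra. }
  (* For this [x] the quotient [x/(1-x)] is [sqrt n], so its square is [n]. *)
  assert (Ht : (x / (1 - x)) ^ 2 <= INR n + 1).
  { rewrite H1x. replace (x / / (1 + sqrt (INR n))) with (sqrt (INR n))
      by (unfold x; field; lra).
    rewrite pow2_sqrt by apply pos_INR. lra. }
  destruct (remainder_bound x fc f n alpha z Hx Hfc Hf Hn Ht Hz Hzx) as (l & Hd & Hl).
  exists l. split; [exact Hd|]. eapply Rle_trans; [exact Hl|].
  rewrite Rmult_assoc. apply Rmult_le_compat_l; [|exact (special_constant n Hn)].
  apply Rdiv_le_0_compat; [apply pow_le, Cnorm_ge0|lra].
Qed.
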